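(* For $E>0$, \[ \min_{\varphi\in L^2_{p,n}([-\pi,\pi])}\{\Delta_\varphi^2(\cos Q,\sin Q):\Delta_\varphi^2P\le E\}=\max_{s>0}\Big(1-\Big(sE-\frac{s\,a_0(2/s)}{4}\Big)^2\Big). \] The minimum is realized by $\varphi$ if and only if $\varphi$ is given as a shift of the Mathieu function $\theta\mapsto\mathrm{ce}_0(\theta/2,-2/s_E)$, where $s_E=\mathrm{argmax}_{s>0}\big(\frac{s\,a_0(2/s)}{4}+1-sE\big)$.
   Context: $L^2_p([-\pi,\pi])$ is the space of $2\pi$-periodic square-integrable functions with inner product $\int_{-\pi}^{\pi}\bar\varphi\psi\,\frac{d\theta}{2\pi}$; $L^2_{p,n}$ its unit vectors. $Q$ is multiplication by $\theta$ (so $\cos Q,\sin Q$ are multiplication by $\cos\theta,\sin\theta$), $P=-i\,d/d\theta$. For an operator $X$, $\Delta_\varphi^2X=\langle\varphi|(X-\langle\varphi|X|\varphi\rangle)^2|\varphi\rangle$, and $\Delta_\varphi^2(\cos Q,\sin Q):=\Delta_\varphi^2\cos Q+\Delta_\varphi^2\sin Q=1-\langle\varphi|\cos Q|\varphi\rangle^2-\langle\varphi|\sin Q|\varphi\rangle^2$. For real $q$, $a_0(q)$ is the smallest eigenvalue of $-\frac{d^2}{dx^2}+2q\cos2x$ on even $\pi$-periodic functions (smallest characteristic value of Mathieu's equation $y''+(a-2q\cos2x)y=0$ with even $\pi$-periodic solution), and $\mathrm{ce}_0(\cdot,q)$ a corresponding eigenfunction. *)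

(* Defs.v *)
From HB Require Import structures.
From mathcomp Require Import all_boot all_order all_algebra.
From mathcomp Require Import all_classical all_reals all_analysis.
Set Implicit Arguments. Unset Strict Implicit. Unset Printing Implicit Defensive.
Import Order.TTheory GRing.Theory Num.Theory.
Import numFieldNormedType.Exports.
Local Open Scope classical_set_scope.
Local Open Scope ring_scope.

Section Defs.
Variable R : realType.

Notation leb := (@lebesgue_measure R).

Definition Iper : set R := `[- pi, pi]%classic.

Definition avg (f : R -> R) : R := (2 * pi)^-1 * \int[leb]_(x in Iper) f x.

Definition sq_int (f : R -> R) : Prop :=
  measurable_fun Iper f /\ leb.-integrable Iper (fun x => ((f x) ^+ 2)%:E).

(* u is 2pi-periodic, absolutely continuous on [-pi,pi] with a square
   integrable (weak) derivative du: i.e. u is (the continuous representative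
   of) an element of the periodic Sobolev space H^1, the form domain of P. *)
Definition H1per_deriv (u du : R -> R) : Prop :=
  (forall x, u (x + 2 * pi) = u x) /\
  sq_int du /\
  (forall x, Iper x -> u x = u (- pi) + \int[leb]_(t in `[- pi, x]%classic) du t).

(* A wave function phi = u + i v (u, v real and imaginary parts),
   with weak derivative phi' = du + i dv. *)

Definition unit_state (u v : R -> R) : Prop :=
  avg (fun x => u x ^+ 2 + v x ^+ 2) = 1.

Definition exp_cos (u v : R -> R) : R := avg (fun x => cos x * (u x ^+ 2 + v x ^+ 2)).
Definition exp_sin (u v : R -> R) : R := avg (fun x => sin x * (u x ^+ 2 + v x ^+ 2)).

Definition var_cos (u v : R -> R) : R :=
  avg (fun x => (cos x - exp_cos u v) ^+ 2 * (u x ^+ 2 + v x ^+ 2)).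
Definition var_sin (u v : R -> R) : R :=
  avg (fun x => (sin x - exp_sin u v) ^+ 2 * (u x ^+ 2 + v x ^+ 2)).

Definition var_cossin (u v : R -> R) : R := var_cos u v + var_sin u v.

(* <phi| P |phi> with P = -i d/dtheta:
   conj(phi) (-i phi') has real part u dv - v du (imaginary part integrates to 0) *)
Definition exp_P (u v du dv : R -> R) : R := avg (fun x => u x * dv x - v x * du x).

(* Delta^2 P = || (P - <P>) phi ||^2 ;
   (P - p) phi = (dv - p u) + i (- du - p v) *)
Definition var_P (u v du dv : R -> R) : R :=
  let p := exp_P u v du dv in
  avg (fun x => (dv x - p * u x) ^+ 2 + (du x + p * v x) ^+ 2).

Definition mathieu_even_sol (a q : R) (y : R -> R) : Prop :=
  (exists x, y x != 0) /\
  (forall x, y (- x) = y x) /\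
  (forall x, y (x + pi) = y x) /\
  (forall x, derivable y x 1 /\ derivable (derive1 y) x 1) /\
  (forall x, derive1 (derive1 y) x + (a - 2 * q * cos (2 * x)) * y x = 0).

Definition mathieu_char_even (q : R) : set R :=
  [set a | exists y, mathieu_even_sol a q y].

Definition a0 (q : R) : R := inf (mathieu_char_even q).

Definition is_ce0 (q : R) (y : R -> R) : Prop := mathieu_even_sol (a0 q) q y.

End Defs.

(* Main.v *)
(* Write [lam(s) = s a_0(2/s) / 4] for the ground state energy of
   [- s d^2/dtheta^2 - cos theta] and [psi] for a positive ground state, and put
   [w = psi'/psi], so that [s (w' + w^2) + cos theta = - lam(s)]. Completing the
   square with [w(theta - th)] and integrating by parts gives, for every unit
   vector [phi] with [<P> = p],
     [s Delta^2 P - <cos(Q - th)> = lam(s) + s ||phi' - i p phi - w(. - th) phi||^2].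
   Hence [<cos(Q - th)> <= s E - lam(s)] for all [th] and [s > 0], which bounds
   [Delta^2(cos Q, sin Q)] from below, with equality only if
   [phi = c psi(. - th) exp(i p theta)], and periodicity makes [p] an integer.
   Solving the linearized Riccati equation shows that [lam] is differentiable,
   with derivative [Delta^2 P] of the ground state; at a minimizer of
   [s E - lam(s)] this derivative equals [E], so the bound is attained.
   The ground state itself comes from shooting: [lam] is the supremum of the
   parameters whose even solution is positive with positive slope at [pi]. *)
Require Import Defs.
From HB Require Import structures.
From mathcomp Require Import all_boot all_order all_algebra.
From mathcomp Require Import all_classical all_reals all_analysis.
From mathcomp Require Import measurable_realfun.
From mathcomp Require Import ring lra.
Set Implicit Arguments. Unset Strict Implicit. Unset Printing Implicit Defensive.
Import Order.TTheory GRing.Theory Num.Theory.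
Import numFieldNormedType.Exports.
Local Open Scope classical_set_scope.
Local Open Scope ring_scope.

(** * Derivatives on the whole line *)

Section Calculus.
Variable R : realType.
Implicit Types (f g : R -> R) (x y a b c d : R).

(** Two obstacles shape the proof. States lie only in the Sobolev space [H^1], with the derivative
    supplied as a separate square-integrable function; so the product rule, integration by parts and
    uniqueness of the derivative are rebuilt for such pairs, while ground states and trial functions
    stay classical. And no spectral theory is used: a positive even periodic solution is
    automatically lowest among the even periodic ones, and its logarithmic derivative certifies the
    energy bound for all states, even or not. The certificate needs no exact solution. Any periodic
    [w] with a pointwise bound on its Riccati expression bounds the energy of every state, which
    covers the ground state, its perturbation to nearby parameters, and the crude trial [- c sin x]
    that keeps the minimizer of [s E - lam(s)] away from 0 and infinity. Differentiability of [lam]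
    enters only as an inequality with a quadratic error, and a slope compatible with it on both
    sides of [s] is forced. The shift by [pi / 2] changes the sign of [q] in Mathieu's equation, so
    [a0 (2 / s)] and the eigenfunction for [- (2 / s)] belong together. *)

Definition der f f' := forall x, is_derive x (1 : R) f (f' x).

Lemma der_eq f f' g' : der f f' -> f' =1 g' -> der f g'.
Proof. by move=> hf e x; apply: is_derive_eq (hf x) (e x). Qed.

Lemma der_ext f g f' : der f f' -> f =1 g -> der g f'.
Proof. by move=> hf /funext <-. Qed.

Lemma der_cst c : der (fun=> c) (fun=> 0).
Proof. by move=> x; exact: is_derive_cst. Qed.

Lemma der_id : der (fun x => x) (fun=> 1).
Proof. by move=> x; exact: is_derive_id. Qed.

Lemma derD f g f' g' : der f f' -> der g g' ->
  der (fun x => f x + g x) (fun x => f' x + g' x).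
Proof. by move=> hf hg x; exact: is_deriveD. Qed.

Lemma derB f g f' g' : der f f' -> der g g' ->
  der (fun x => f x - g x) (fun x => f' x - g' x).
Proof. by move=> hf hg x; exact: is_deriveB. Qed.

Lemma derN f f' : der f f' -> der (fun x => - f x) (fun x => - f' x).
Proof. by move=> hf x; exact: is_deriveN. Qed.

Lemma derM f g f' g' : der f f' -> der g g' ->
  der (fun x => f x * g x) (fun x => f' x * g x + f x * g' x).
Proof.
move=> hf hg x; apply: is_derive_eq (is_deriveM (hf x) (hg x)) _.
by rewrite /GRing.scale /=; ring.
Qed.

Lemma derZ c f f' : der f f' -> der (fun x => c * f x) (fun x => c * f' x).
Proof. by move=> hf; apply: der_eq (derM (der_cst c) hf) _ => x; ring. Qed.

Lemma der_comp f g f' g' : der f f' -> der g g' ->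
  der (fun x => f (g x)) (fun x => f' (g x) * g' x).
Proof. by move=> hf hg x; exact: is_derive1_comp. Qed.

Lemma derV f f' : der f f' -> (forall x, f x != 0) ->
  der (fun x => (f x)^-1) (fun x => - f' x / f x ^+ 2).
Proof.
move=> hf f0 x; apply: is_derive_eq (is_deriveV (f0 x) (hf x)) _.
by rewrite /GRing.scale /= !mulNr mulrC.
Qed.

Lemma der_sin : der sin cos.
Proof. by move=> x; exact: is_derive_sin. Qed.

Lemma der_cos : der cos (fun x => - sin x).
Proof. by move=> x; exact: is_derive_cos. Qed.

Lemma der_exp : der expR expR.
Proof. by move=> x; exact: is_derive_expR. Qed.

Lemma der_affine c d : der (fun x => c * x + d) (fun=> c).
Proof. by apply: der_eq (derD (derZ c der_id) (der_cst d)) _ => x; ring. Qed.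

Lemma der_derivable f f' x : der f f' -> derivable f x 1.
Proof. by move=> h; exact: ex_derive. Qed.

Lemma der_derive1 f f' : der f f' -> derive1 f = f'.
Proof. by move=> h; apply/funext => x; rewrite derive1E; exact: derive_val. Qed.

Lemma derivable_der f : (forall x, derivable f x 1) -> der f (derive1 f).
Proof. by move=> h x; rewrite derive1E; apply/derivableP. Qed.

Lemma der_unique f f' g' : der f f' -> der f g' -> f' = g'.
Proof. by move=> h1 h2; rewrite -(der_derive1 h1) -(der_derive1 h2). Qed.

Lemma der_continuous f f' : der f f' -> continuous f.
Proof.
by move=> h x; apply/differentiable_continuous/derivable1_diffP; exact: der_derivable h.
Qed.

Lemma within_cts f (A : set R) : continuous f -> {within A, continuous f}.
Proof. by move=> cf; exact: continuous_subspaceT. Qed.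

Lemma der_le0_nincr f f' a b : der f f' -> (forall x, a < x < b -> f' x <= 0) ->
  a <= b -> f b <= f a.
Proof.
move=> h f0 ab.
apply: (@ler0_derive1_nincr _ f a b) => //.
- by move=> x _; exact: der_derivable h.
- by move=> x; rewrite in_itv /= (der_derive1 h); exact: f0.
- exact/within_cts/der_continuous/h.
Qed.

Lemma der_ge0_ndecr f f' a b : der f f' -> (forall x, a < x < b -> 0 <= f' x) ->
  a <= b -> f a <= f b.
Proof.
move=> h f0 ab; rewrite -lerN2; apply: (der_le0_nincr (derN h)) => // x xab.
by rewrite oppr_le0 f0.
Qed.

Lemma der_le f g f' g' a b : der f f' -> der g g' ->
  (forall x, a < x < b -> f' x <= g' x) -> a <= b -> f b - f a <= g b - g a.
Proof.
move=> hf hg le ab.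
have := der_le0_nincr (derB hf hg) (a := a) (b := b) _ ab.
have P x : a < x < b -> f' x - g' x <= 0 by move/le; rewrite subr_le0.
by move=> /(_ P); lra.
Qed.

Lemma der_norm_le f g f' g' a b : der f f' -> der g g' ->
  (forall x, a < x < b -> `|f' x| <= g' x) -> a <= b -> `|f b - f a| <= g b - g a.
Proof.
move=> hf hg le ab; rewrite ler_norml; apply/andP; split; last first.
  by apply: (der_le hf hg) => // x /le; apply: le_trans; exact: ler_norm.
suff : - f b - - f a <= g b - g a by lra.
apply: (der_le (derN hf) hg) => // x /le; apply: le_trans.
by rewrite -normrN; exact: ler_norm.
Qed.

Lemma der0_cst f : der f (fun=> 0) -> forall x y, f x = f y.
Proof. by move=> h x y; exact: is_derive_0_is_cst. Qed.

Lemma der_continuous_primitive f : continuous f -> exists2 F, der F f & F 0 = 0.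
Proof.
move=> cf.
pose mu := @lebesgue_measure R.
have If a b : mu.-integrable `[a, b] (EFin \o f).
  apply: continuous_compact_integrable; first exact: segment_compact.
  exact: within_cts.
pose G a x := (\int[mu]_(t in `[a, x]) f t)%R.
have GB a b x : a <= b -> b <= x -> G a x = G a b + G b x.
  move=> ab bx; rewrite -[RHS]addrC; apply/eqP; rewrite -subr_eq; apply/eqP.
  rewrite /G (@Rintegral_itvB _ f (BLeft a) (BRight x) b) //.
    rewrite Rintegral_itv_obnd_cbnd //.
    by apply: (integrableS _ _ _ (If b x)) => //; apply: subset_itvr; rewrite bnd_simp.
(* The base point [- (|x| + 1)] lies to the left of both 0 and x, so one formula serves both signs
   of x; [FE] shows that any other such base point gives the same value. *)
pose F x := G (- (`|x| + 1)) x - G (- (`|x| + 1)) 0.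
have FE a x : a <= x -> a <= 0 -> F x = G a x - G a 0.
  move=> ax a0; rewrite /F; set c := - (`|x| + 1).
  have cx : c <= x by rewrite /c; have := ler_norm (-x); rewrite normrN; lra.
  have c0 : c <= 0 by rewrite /c; have := normr_ge0 x; lra.
  have [ac|/ltW ca] := leP a c.
    by rewrite (GB a c x) // (GB a c 0) //; lra.
  by rewrite (GB c a x) // (GB c a 0) //; lra.
exists F; last by rewrite /F; lra.
move=> x; pose a := - (`|x| + 1).
have ax : a < x by rewrite /a; have := ler_norm (-x); rewrite normrN; lra.
have a0 : a <= 0 by rewrite /a; have := normr_ge0 x; lra.
have : is_derive x (1 : R) (fun y => G a y - G a 0) (f x).
  have [|dG eG] := @continuous_FTC1_closed R f a x (x + 1) _ (If _ _) ax (cf x).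
    by lra.
  have hG : is_derive x (1 : R) (G a) (f x).
    by split => //; rewrite -derive1E.
  apply: is_derive_eq (is_deriveB hG (is_derive_cst (G a 0) x 1)) _.
  by rewrite subr0.
apply: near_eq_is_derive.
near=> y; rewrite (FE a) //; apply: ltW; near: y.
exact: lt_nbhsr.
Unshelve. all: by end_near. Qed.

End Calculus.

(** * Linear second order equations *)

Section LinearODE.
Variable R : realType.
Implicit Types (f g : R -> R) (x y a b c d : R).

Lemma small_half_power (C e : R) : 0 < e -> exists n, C / 2 ^+ n < e.
Proof.
move=> e0; exists (Num.bound (`|C| / e)).
have n0 : (0 : R) < 2 ^+ Num.bound (`|C| / e) by rewrite exprn_gt0.
rewrite ltr_pdivrMr // mulrC -ltr_pdivrMr //.
apply: le_lt_trans (_ : `|C| / e < _).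
  by rewrite ler_pM2r ?invr_gt0 // ler_norm.
apply: lt_trans (archi_boundP _) _; first by rewrite divr_ge0 // ltW.
by rewrite -natrX ltr_nat ltn_expl.
Qed.

Lemma half_power_eq0 (a C : R) : (forall n, `|a| <= C / 2 ^+ n) -> a = 0.
Proof.
move=> h; apply/eqP; rewrite -normr_eq0; apply/negPn/negP => a0.
have {}a0 : 0 < `|a| by rewrite lt_def a0 normr_ge0.
have [n] := small_half_power C a0.
by rewrite ltNge h.
Qed.

(** The tail of the geometric series is [2 C / 2^n], so the intervals of that radius around [u n]
    are nested; the limit is the supremum of their left ends. *)
Lemma geometric_cauchy (u : nat -> R) (C : R) :
  (forall n, `|u n.+1 - u n| <= C / 2 ^+ n) ->
  exists l, forall n, `|l - u n| <= 2 * C / 2 ^+ n.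
Proof.
move=> h.
have step n : C / 2 ^+ n = 2 * C / 2 ^+ n - 2 * C / 2 ^+ n.+1.
  by have : (2 : R) ^+ n != 0 := lt0r_neq0 (exprn_gt0 n (ltr0Sn R 1)); rewrite exprS => ?; field.
have lo : {homo (fun n => u n - 2 * C / 2 ^+ n) : m n / (m <= n)%N >-> m <= n}.
  apply: homo_leq => [//||n]; first exact: le_trans.
  by have := h n; rewrite step ler_norml => /andP[]; lra.
have hi : {homo (fun n => - (u n + 2 * C / 2 ^+ n)) : m n / (m <= n)%N >-> m <= n}.
  apply: homo_leq => [//||n]; first exact: le_trans.
  by have := h n; rewrite step ler_norml => /andP[]; lra.
have C0 : 0 <= C by have := h 0%N; rewrite expr0 divr1; apply: le_trans.
have p0 n : 0 <= 2 * C / 2 ^+ n by rewrite divr_ge0 ?mulr_ge0 ?exprn_ge0.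
pose S := [set u n - 2 * C / 2 ^+ n | n in @setT nat].
have ub n : ubound S (u n + 2 * C / 2 ^+ n).
  move=> _ [m _ <-].
  have := lo _ _ (leq_maxl m n); have := hi _ _ (leq_maxr m n).
  by have := p0 (maxn m n); rewrite /=; lra.
have S0 : S !=set0 by exists (u 0%N - 2 * C / 2 ^+ 0); exists 0%N.
exists (sup S) => n; rewrite ler_norml.
have : sup S <= u n + 2 * C / 2 ^+ n by apply: ge_sup => //; exact: ub.
have : u n - 2 * C / 2 ^+ n <= sup S.
  by apply: ub_le_sup; [exists (u 0%N + 2 * C / 2 ^+ 0); exact: ub | exists n].
by move=> ? ?; apply/andP; split; lra.
Qed.

(** The error bound may grow with x, as the Picard bounds do; continuity of [B] makes the
    convergence uniform near each point. *)
Lemma locally_uniform_continuous (g_ : nat -> R -> R) g (B : R -> R) :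
  (forall n, continuous (g_ n)) -> continuous B ->
  (forall n x, `|g x - g_ n x| <= B x / 2 ^+ n) -> continuous g.
Proof.
move=> cg cB h x; apply/cvgrPdist_lt => e e0.
have B0 y : 0 <= B y.
  by have := h 0%N y; rewrite expr0 divr1; apply: le_trans.
have e3 : 0 < e / 3 by lra.
have [n hn] := small_half_power (B x + 1) e3.
have p0 : (0 : R) < 2 ^+ n by rewrite exprn_gt0.
near=> y.
have By : B y <= B x + 1.
  have : `|B x - B y| < 1 by near: y; apply: cvgr_dist_lt => //; exact: cB.
  by rewrite ltr_norml => /andP[]; lra.
have gy : `|g_ n x - g_ n y| < e / 3.
  by near: y; apply: cvgr_dist_lt => //; exact: cg.
have hx : `|g x - g_ n x| < e / 3.
  apply: le_lt_trans (h n x) _; apply: le_lt_trans hn.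
  by rewrite ler_pM2r ?invr_gt0 //; lra.
have hy : `|g y - g_ n y| < e / 3.
  apply: le_lt_trans (h n y) _; apply: le_lt_trans hn.
  by rewrite ler_pM2r ?invr_gt0.
by move: gy hx hy; rewrite !ltr_norml => /andP[? ?] /andP[? ?] /andP[? ?]; apply/andP; split; lra.
Unshelve. all: by end_near. Qed.

(** With [G] a primitive of [g], the increments of [f] and of [G] both differ from those of [f_ n]
    by a multiple of [2^-n], so [f - G] is constant. *)
Lemma locally_uniform_der (f_ g_ : nat -> R -> R) f g (B : R -> R) :
  (forall n, der (f_ n) (g_ n)) -> (forall n, continuous (g_ n)) -> continuous B ->
  (forall n x, `|f x - f_ n x| <= B x / 2 ^+ n) ->
  (forall n x, `|g x - g_ n x| <= B x / 2 ^+ n) -> der f g.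
Proof.
move=> hd cg cB hf hg.
have [G dG G0] := der_continuous_primitive (locally_uniform_continuous cg cB hg).
have [BB dBB _] := der_continuous_primitive cB.
apply: der_ext (_ : der (fun x => f 0 + G x) g) _.
  by apply: der_eq (derD (der_cst (f 0)) dG) _ => x; rewrite add0r.
have key a b : a <= b -> f a - G a = f b - G b.
  move=> ab; apply/eqP; rewrite -subr_eq0; apply/eqP.
  apply: (@half_power_eq0 _ (B a + B b + (BB b - BB a))) => n.
  have := der_norm_le (derB dG (hd n)) (derZ (2 ^+ n)^-1 dBB) _ ab.
  have P x : a < x < b -> `|g x - g_ n x| <= (2 ^+ n)^-1 * B x.
    by rewrite mulrC => _; exact: hg.
  move=> /(_ P); have := hf n a; have := hf n b; rewrite mulrDl mulrDl mulrBl.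
  rewrite ![(2 ^+ n)^-1 * _]mulrC !ler_norml.
  move=> /andP[? ?] /andP[? ?] /andP[? ?]; apply/andP; split; lra.
move=> x; have [/key|/ltW/key] := leP 0 x; rewrite G0; lra.
Qed.

(** The Picard iteration is a recursion on plain functions, so taking primitives must be a total
    operator; its value at a discontinuous function is junk. *)
Lemma primitive_operator : exists prim : (R -> R) -> R -> R,
  forall f, continuous f -> der (prim f) f /\ prim f 0 = 0.
Proof.
have /choice[prim hprim] f : exists F, continuous f -> der F f /\ F 0 = 0; last first.
  by exists prim.
have [/der_continuous_primitive[F ? ?]|] := pselect (continuous f).
  by exists F.
by move=> ?; exists f.
Qed.

(** * Picard iteration on the whole line with an exponential weight *)

Section Picard.
Variables (V : R -> R) (M : R).
Hypotheses (cV : continuous V) (M1 : 1 <= M) (VM : forall x, `|V x| <= M).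

(** Since [S' = K E], [S 0 = 0] and [|S| <= E], integrating from 0 a function bounded by [c K E]
    yields one bounded by [c E]. The potential costs a factor [M = K / 2], so each iteration halves
    the error on the whole line at once; [1 <= M] gives the same gain in the equation [P' = Q]. *)
Let K := 2 * M.
Let E x := expR (K * x) + expR (- K * x).
Let S x := expR (K * x) - expR (- K * x).

Let dS : der S (fun x => K * E x).
Proof.
have h c : der (fun x => expR (c * x)) (fun x => expR (c * x) * c).
  apply: der_eq (der_comp (@der_exp R) (derZ c (@der_id R))) _ => x /=.
  by rewrite mulr1.
by apply: der_eq (derB (h K) (h (- K))) _ => x; rewrite /E; ring.
Qed.

Let cE : continuous E.
Proof.
have h c : continuous (fun x => expR (c * x)).
  exact: der_continuous (der_comp (@der_exp R) (derZ c (@der_id R))).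
by move=> x; apply: cvgD; [exact: h|exact: h].
Qed.

Let E1 x : 1 <= E x.
Proof.
rewrite /E; have := expR_ge1Dx (K * x); have := expR_ge1Dx (- K * x).
have := expR_gt0 (K * x); have := expR_gt0 (- K * x).
by have [|] := leP 0 (K * x); lra.
Qed.

Let gain D D' c : der D D' -> D 0 = 0 -> (forall x, `|D' x| <= c * (K * E x)) ->
  forall x, `|D x| <= c * E x.
Proof.
move=> dD D0 h x.
have c0 : 0 <= c.
  have := le_trans (normr_ge0 _) (h 0); rewrite pmulr_lge0 // mulr_gt0 ?(lt_le_trans ltr01) //.
  by rewrite /K; have := M1; lra.
have SE : c * S x <= c * E x.
  by apply: ler_wpM2l => //; rewrite /S /E; have := expR_gt0 (- K * x); lra.
have SE' : - (c * S x) <= c * E x.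
  rewrite -mulrN; apply: ler_wpM2l => //.
  by rewrite /S /E; have := expR_gt0 (K * x); lra.
have S0 : S 0 = 0 by rewrite /S !mulr0 subrr.
have [x0|/ltW x0] := leP 0 x.
  have := der_norm_le dD (derZ c dS) (fun y _ => h y) x0.
  by rewrite D0 S0 subr0; lra.
have := der_norm_le dD (derZ c dS) (fun y _ => h y) x0.
by rewrite D0 S0 sub0r normrN; lra.
Qed.

Lemma linear_ivp : exists P Q : R -> R,
  [/\ der P Q, der Q (fun x => V x * P x), P 0 = 1 & Q 0 = 0].
Proof.
have [prim hprim] := primitive_operator.
pose it := fix it n : (R -> R) * (R -> R) :=
  if n is n'.+1 then let: (P, Q) := it n' in
    (fun x => 1 + prim Q x, prim (fun x => V x * P x))
  else (fun=> 0, fun=> 0).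
pose P n := (it n).1; pose Q n := (it n).2.
have PS n : P n.+1 = fun x => 1 + prim (Q n) x by rewrite /P /Q /=; case: (it n).
have QS n : Q n.+1 = prim (fun x => V x * P n x) by rewrite /P /Q /=; case: (it n).
have cVM f : continuous f -> continuous (fun x => V x * f x).
  by move=> cf x; apply: cvgM; [exact: cV|exact: cf].
have cPQ n : continuous (P n) /\ continuous (Q n).
  elim: n => [|n [cP cQ]]; first by split => x; exact: cvg_cst.
  rewrite PS QS; split; last exact: der_continuous (hprim _ (cVM _ cP)).1.
  exact: der_continuous (derD (der_cst 1) (hprim _ cQ).1).
have dP n : der (P n.+1) (Q n).
  rewrite PS; apply: der_eq (derD (der_cst 1) (hprim _ (cPQ n).2).1) _ => x.
  by rewrite add0r.
have dQ n : der (Q n.+1) (fun x => V x * P n x).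
  by rewrite QS; exact: (hprim _ (cVM _ (cPQ n).1)).1.
have P0 n : P n.+1 0 = 1 by rewrite PS (hprim _ (cPQ n).2).2 addr0.
have Q0 n : Q n 0 = 0.
  by case: n => // n; rewrite QS (hprim _ (cVM _ (cPQ n).1)).2.
have M0 : 0 <= M by have := M1; lra.
(* The iteration starts from the pair (0, 0), whose first component misses the initial value 1, so
   differences are taken from index 1 on. *)
have bound n x : `|P n.+2 x - P n.+1 x| <= E x / 2 ^+ n /\
                 `|Q n.+2 x - Q n.+1 x| <= E x / 2 ^+ n.
  elim: n x => [|n IH] x.
    rewrite expr0 divr1 -[E x]mul1r; split.
      apply: (gain (derB (dP 1%N) (dP 0%N))); first by rewrite !P0 subrr.
      have Q10 y : Q 1%N y = Q 0%N y.
        have := der_eq (dQ 0%N) (fun y => mulr0 (V y)) => /der0_cst /(_ y 0) ->.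
        exact: Q0.
      move=> y; rewrite Q10 subrr normr0 mul1r.
      by have := E1 y; rewrite /K => ?; rewrite !mulr_ge0 //; lra.
    apply: (gain (derB (dQ 1%N) (dQ 0%N))); first by rewrite !Q0 subrr.
    move=> y; rewrite mul1r {2}/P /= mulr0 subr0 normrM.
    have -> : P 1%N y = 1.
      have := @der0_cst _ _ (dP 0%N) y 0; rewrite P0; apply.
    rewrite normr1 mulr1; apply: le_trans (VM y) _; rewrite /K.
    have : M <= M * E y by rewrite ler_peMr.
    by rewrite -mulrA; lra.
  have hh : (2 ^+ n.+1)^-1 * 2 = (2 ^+ n)^-1 :> R.
    by have : (2 : R) ^+ n != 0 := lt0r_neq0 (exprn_gt0 n (ltr0Sn R 1)); rewrite exprS => ?; field.
  rewrite [E x / _]mulrC; split.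
    apply: (gain (derB (dP n.+2) (dP n.+1))); first by rewrite !P0 subrr.
    move=> y; apply: le_trans (IH y).2 _.
    rewrite /K -mulrA [X in _ <= X]mulrA hh mulrC ler_wpM2l ?invr_ge0 ?exprn_ge0 //.
    by rewrite ler_peMl // ltW // (lt_le_trans ltr01).
  apply: (gain (derB (dQ n.+2) (dQ n.+1))); first by rewrite !Q0 subrr.
  move=> y; rewrite -mulrBr normrM.
  apply: le_trans (ler_pM (normr_ge0 _) (normr_ge0 _) (VM y) (IH y).1) _.
  by rewrite /K -mulrA [X in _ <= X]mulrA hh; lra.
have /choice[p hp] x : exists l, forall n, `|l - P n.+1 x| <= 2 * E x / 2 ^+ n.
  by apply: (@geometric_cauchy (fun n => P n.+1 x)) => n; exact: (bound n x).1.
have /choice[q hq] x : exists l, forall n, `|l - Q n.+1 x| <= 2 * E x / 2 ^+ n.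
  by apply: (@geometric_cauchy (fun n => Q n.+1 x)) => n; exact: (bound n x).2.
have c2E : continuous (fun x => K * (2 * E x)).
  move=> x; apply: cvgM; first exact: cvg_cst.
  by apply: cvgM; [exact: cvg_cst|exact: cE].
have EK n x : 2 * E x / 2 ^+ n <= K * (2 * E x) / 2 ^+ n.
  rewrite ler_wpM2r ?invr_ge0 ?exprn_ge0 // ler_peMl //; last by have := M1; rewrite /K; lra.
  by have := E1 x; lra.
have EKS n x : 2 * E x / 2 ^+ n.+1 <= K * (2 * E x) / 2 ^+ n.
  apply: le_trans (EK n x); rewrite ler_wpM2l //; first by have := E1 x; lra.
  by rewrite lef_pV2 ?posrE ?exprn_gt0 // exprS ler_peMl ?exprn_ge0 // ler1n.
exists p, q; split.
- apply: (@locally_uniform_der (fun n => P n.+2) (fun n => Q n.+1) _ _ _ _ _ c2E).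
  + by move=> n; exact: dP.
  + by move=> n; exact: (cPQ _).2.
  + by move=> n x; apply: le_trans (hp x n.+1) _; exact: EKS.
  + by move=> n x; apply: le_trans (hq x n) _; exact: EK.
- apply: (@locally_uniform_der (fun n => Q n.+2) (fun n x => V x * P n.+1 x) _ _ _ _ _ c2E).
  + by move=> n; exact: dQ.
  + by move=> n; exact/cVM/(cPQ _).1.
  + by move=> n x; apply: le_trans (hq x n.+1) _; exact: EKS.
  + move=> n x; rewrite -mulrBr normrM.
    apply: le_trans (ler_pM (normr_ge0 _) (normr_ge0 _) (VM x) (hp x n)) _.
    rewrite [M * _]mulrA; apply: ler_wpM2r; first by rewrite invr_ge0 exprn_ge0.
    apply: ler_wpM2r; first by have := E1 x; lra.
    by rewrite /K; have := M1; lra.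
- apply/eqP; rewrite -subr_eq0; apply/eqP.
  by apply: (@half_power_eq0 _ (2 * E 0)) => n; have := hp 0 n; rewrite P0.
- by apply: (@half_power_eq0 _ (2 * E 0)) => n; have := hq 0 n; rewrite Q0 subr0.
Qed.

End Picard.

(** [D^2 + D1^2 + e^2] times [exp (- (M + 2) x)] is nonincreasing: Young's inequality turns
    [2 (1 + M) |D D1|] into the factor [1 + M] and [2 e |D1|] into one more. The case [e = 0] gives
    uniqueness; a positive [e] measures the effect of changing the parameter in the equation. *)
Lemma gronwall (D D1 D2 : R -> R) (M e a b : R) : der D D1 -> der D1 D2 -> 0 <= M ->
  (forall x, a < x < b -> `|D2 x| <= M * `|D x| + e) ->
  D a = 0 -> D1 a = 0 -> a <= b ->
  D b ^+ 2 + D1 b ^+ 2 <= e ^+ 2 * expR ((M + 2) * (b - a)).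
Proof.
move=> dD dD1 M0 h Da D1a ab.
pose K := M + 2.
pose f x := (D x * D x + D1 x * D1 x + e ^+ 2) * expR (- K * x).
have df := derM (derD (derD (derM dD dD) (derM dD1 dD1)) (der_cst (e ^+ 2)))
             (der_comp (@der_exp R) (derZ (- K) (@der_id R))).
have : f b <= f a.
  apply: (der_le0_nincr df) => // x xab; rewrite mulr1.
  set ex := expR _; have ex0 : 0 < ex by exact: expR_gt0.
  have -> : forall A B : R, A * ex + B * (ex * - K) = (A - K * B) * ex by move=> A B; ring.
  rewrite pmulr_lle0 // subr_le0 addr0.
  have {h} hx := h x xab.
  have h1 : D1 x * D2 x <= `|D1 x| * (M * `|D x| + e).
    apply: le_trans (ler_norm _) _; rewrite normrM ler_wpM2l //.
  have h2 : D x * D1 x <= `|D x| * `|D1 x| by rewrite -normrM ler_norm.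
  have s1 : D x * D x = `|D x| * `|D x| by rewrite -!expr2 real_normK ?num_real.
  have s2 : D1 x * D1 x = `|D1 x| * `|D1 x| by rewrite -!expr2 real_normK ?num_real.
  rewrite s1 s2 /K.
  move: (normr_ge0 (D x)) (normr_ge0 (D1 x)) h1 h2.
  move: `|D x| `|D1 x| => A B A0 B0 h1 h2.
  have q1 : 0 <= (1 + M) * (A - B) ^+ 2 by rewrite mulr_ge0 ?sqr_ge0 //; lra.
  have q2 : 0 <= (B - e) ^+ 2 by exact: sqr_ge0.
  have q3 : 0 <= (M + 1) * e ^+ 2 by rewrite mulr_ge0 ?sqr_ge0 //; lra.
  have q4 : 0 <= A ^+ 2 by exact: sqr_ge0.
  have -> : D1 x * D x + D x * D1 x + (D2 x * D1 x + D1 x * D2 x)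
    = 2 * (D x * D1 x) + 2 * (D1 x * D2 x) by ring.
  rewrite -subr_ge0; nra.
rewrite /f Da D1a !mulr0 !add0r !mulNr !expRN -!expr2.
rewrite mulrBr expRB ler_pdivrMr ?expR_gt0 // => h1.
by have := sqr_ge0 e; lra.
Qed.

Lemma linear_ivp_unique (V D D1 : R -> R) (M x0 : R) : der D D1 ->
  der D1 (fun x => V x * D x) -> (forall x, `|V x| <= M) ->
  D x0 = 0 -> D1 x0 = 0 -> forall x, D x = 0.
Proof.
move=> dD dD1 VM Dx0 D1x0 x.
have M0 : 0 <= M by exact: le_trans (VM 0).
have fwd (A B C : R -> R) a b : der A B -> der B C -> (forall x, `|C x| <= M * `|A x|) ->
    A a = 0 -> B a = 0 -> a <= b -> A b = 0.
  move=> dA dB h Aa Ba ab.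
  have := @gronwall A B C M 0 a b dA dB M0 _ Aa Ba ab.
  have P y : a < y < b -> `|C y| <= M * `|A y| + 0 by move=> _; rewrite addr0.
  move=> /(_ P); rewrite expr0n mul0r => h1; apply/eqP; rewrite -sqrf_eq0 eq_le sqr_ge0 andbT.
  by have := sqr_ge0 (B b); lra.
have bd y : `|V y * D y| <= M * `|D y| by rewrite normrM ler_wpM2r.
have [xx|/ltW xx] := leP x0 x; first exact: (fwd _ _ _ x0 x dD dD1).
have d1 : der (fun y => D (- y)) (fun y => - D1 (- y)).
  by apply: der_eq (der_comp dD (derN (@der_id R))) _ => y; rewrite mulrN1.
have d2 : der (fun y => - D1 (- y)) (fun y => V (- y) * D (- y)).
  by apply: der_eq (derN (der_comp dD1 (derN (@der_id R)))) _ => y; rewrite mulrN1 opprK.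
rewrite -[x]opprK; apply: (fwd _ _ _ (- x0) (- x) d1 d2).
- by move=> y; exact: bd.
- by rewrite opprK.
- by rewrite opprK D1x0 oppr0.
- by rewrite lerN2.
Qed.

End LinearODE.

(** * Even periodic solutions and the ground state *)

Section GroundState.
Variable R : realType.
Implicit Types (f g : R -> R) (x y a b c d s mu lam : R).

Lemma periodic_int (f : R -> R) T : (forall x, f (x + T) = f x) ->
  forall (k : int) x, f (x + k%:~R * T) = f x.
Proof.
move=> h; have hn (n : nat) x : f (x + n%:R * T) = f x.
  elim: n => [|n IH]; first by rewrite mul0r addr0.
  by rewrite -natr1 mulrDl mul1r addrA h IH.
case=> n x; first by rewrite -pmulrn hn.
by rewrite NegzE mulrNz -pmulrn -[RHS](hn n.+1 _) mulNr -[in RHS](subrK (n.+1%:R * T) x) hn.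
Qed.

Lemma reduce_2pi x : exists2 k : int, - pi <= x + k%:~R * (2 * pi) & x + k%:~R * (2 * pi) <= pi.
Proof.
have p0 : 0 < 2 * pi :> R by rewrite mulr_gt0 // pi_gt0.
pose t := (x + pi) / (2 * pi).
have xt : x + pi = t * (2 * pi) by rewrite /t divfK // gt_eqF.
exists (- Num.floor t); rewrite mulrNz mulNr.
  have : (Num.floor t)%:~R * (2 * pi) <= t * (2 * pi).
    by rewrite ler_pM2r // Num.Theory.ge_floor.
  by lra.
have : t * (2 * pi) <= (Num.floor t + 1)%:~R * (2 * pi).
  by rewrite ler_pM2r // ltW // Num.Theory.floorD1_gt.
by rewrite intrD mulrDl mul1r; lra.
Qed.

Lemma der_periodic f f' T : der f f' -> (forall x, f (x + T) = f x) ->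
  forall x, f' (x + T) = f' x.
Proof.
move=> df fT x.
have : der f (fun x => f' (x + T)).
  apply: der_ext (_ : der (fun x => f (x + T)) _) fT.
  by apply: der_eq (der_comp df (derD (@der_id R) (der_cst T))) _ => y; rewrite addr0 mulr1.
by move=> /(der_unique df) /(congr1 (fun h => h x)).
Qed.

(** For any a and b, moving a by enough periods puts it to the right of b without changing [f a], so
    [f a <= f b] for every pair. *)
Lemma periodic_nincr_cst f f' T : 0 < T -> der f f' -> (forall x, f (x + T) = f x) ->
  (forall x, f' x <= 0) -> forall x, f' x = 0.
Proof.
move=> T0 df fT f0.
have inc a b : a <= b -> f b <= f a by apply: (der_le0_nincr df) => x _; exact: f0.
have le a b : f a <= f b.
  rewrite -(periodic_int fT (Num.floor ((b - a) / T) + 1) a); apply: inc.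
  have : (b - a) / T * T <= (Num.floor ((b - a) / T) + 1)%:~R * T.
    by rewrite ler_pM2r // ltW // Num.Theory.floorD1_gt.
  by rewrite divfK ?gt_eqF //; lra.
have fE : f =1 fun=> f 0 by move=> x; apply/eqP; rewrite eq_le !le.
by move=> x; rewrite (der_unique df (der_ext (der_cst (f 0)) (fsym fE))).
Qed.

(* [f] solves [- s f'' - cos f = mu f]; with [x = 2 t] this is Mathieu's
   equation for [a = 4 mu / s], [q = - 2 / s]. *)
Definition even_solution s mu f f' :=
  [/\ forall x, f (- x) = f x, forall x, f (x + 2 * pi) = f x, der f f' &
      der f' (fun x => - ((mu + cos x) / s) * f x)].

Definition ground_state s lam psi psi' :=
  even_solution s lam psi psi' /\ forall x, 0 < psi x.

Lemma even_solution_mathieu s mu f f' : 0 < s -> even_solution s mu f f' ->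
  (exists x, f x != 0) -> mathieu_even_sol (4 * mu / s) (- (2 / s)) (fun x => f (2 * x)).
Proof.
move=> s0 [ev per df df'] [x0 fx0].
have d1 : der (fun x => f (2 * x)) (fun x => 2 * f' (2 * x)).
  by apply: der_eq (der_comp df (derZ 2 (@der_id R))) _ => x; rewrite mulr1 mulrC.
have d2 := derZ 2 (der_comp df' (derZ 2 (@der_id R))).
split; [|split; [|split; [|split]]].
- by exists (x0 / 2); rewrite mulrC divfK.
- by move=> x; rewrite mulrN ev.
- by move=> x; rewrite mulrDr per.
- move=> x; split; first exact: der_derivable d1.
  by rewrite (der_derive1 d1); exact: der_derivable d2.
- move=> x; rewrite (der_derive1 d1) (der_derive1 d2).
  by field; rewrite gt_eqF.
Qed.

Lemma mathieu_even_solution s b z : 0 < s -> mathieu_even_sol b (- (2 / s)) z ->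
  exists f', even_solution s (s * b / 4) (fun x => z (x / 2)) f'.
Proof.
move=> s0 [_ [ev [per [dz eqz]]]].
have d1 : der z (derive1 z) by apply: derivable_der => x; exact: (dz x).1.
have d2 : der (derive1 z) (derive1 (derive1 z)).
  by apply: derivable_der => x; exact: (dz x).2.
have dh : der (fun x => x / 2) (fun=> 2^-1 : R).
  by apply: der_ext (der_eq (derZ 2^-1 (@der_id R)) _) _ => x; rewrite ?mulr1 // mulrC.
exists (fun x => 2^-1 * derive1 z (x / 2)); split.
- by move=> x; rewrite mulNr ev.
- by move=> x; rewrite mulrDl [2 * pi]mulrC mulfK ?per.
- by apply: der_eq (der_comp d1 dh) _ => x; rewrite mulrC.
- apply: der_eq (derZ 2^-1 (der_comp d2 dh)) _ => x.
  have := eqz (x / 2); rewrite [2 * (x / 2)]mulrC divfK // => /eqP.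
  rewrite addrC addr_eq0 => /eqP h.
  have -> : derive1 (derive1 z) (x / 2) = - ((b - 2 * - (2 / s) * cos x) * z (x / 2)).
    by rewrite h opprK.
  by field; rewrite gt_eqF.
Qed.

(** The shift by [pi / 2] reverses the sign of [cos (2 x)], and evenness survives because the period
    is pi. *)
Lemma mathieu_shift a q z : mathieu_even_sol a q z ->
  mathieu_even_sol a (- q) (fun x => z (x + pi / 2)).
Proof.
move=> [[x0 zx0] [ev [per [dz eqz]]]].
have d1 : der z (derive1 z) by apply: derivable_der => x; exact: (dz x).1.
have d2 : der (derive1 z) (derive1 (derive1 z)).
  by apply: derivable_der => x; exact: (dz x).2.
have ds : der (fun x => x + pi / 2) (fun=> 1 : R).
  by apply: der_eq (derD (@der_id R) (der_cst _)) _ => x; rewrite addr0.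
have e1 : der (fun x => z (x + pi / 2)) (fun x => derive1 z (x + pi / 2)).
  by apply: der_eq (der_comp d1 ds) _ => x; rewrite mulr1.
have e2 : der (fun x => derive1 z (x + pi / 2)) (fun x => derive1 (derive1 z) (x + pi / 2)).
  by apply: der_eq (der_comp d2 ds) _ => x; rewrite mulr1.
split; [|split; [|split; [|split]]].
- by exists (x0 - pi / 2); rewrite subrK.
- by move=> x; rewrite -[RHS]ev -[RHS]per; congr z; field.
- by move=> x; rewrite addrAC per.
- move=> x; split; first exact: der_derivable e1.
  by rewrite (der_derive1 e1); exact: der_derivable e2.
- move=> x; rewrite (der_derive1 e1) (der_derive1 e2) -[RHS](eqz (x + pi / 2)).
  have -> : 2 * (x + pi / 2) = 2 * x + pi by field.
  by rewrite cosDpi; ring.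
Qed.

Lemma a0N q : a0 (- q) = a0 q :> R.
Proof.
rewrite /a0; congr (inf _); apply/seteqP; split=> a [z hz].
  by exists (fun x => z (x + pi / 2)); rewrite -[q]opprK; exact: mathieu_shift.
by exists (fun x => z (x + pi / 2)); exact: mathieu_shift.
Qed.

(* [w f^2 - f f'] is periodic with derivative
   [- (f' - w f)^2 + (mu - lam) / s * f^2], where [w = psi' / psi]. *)
Lemma ground_state_comparison s lam psi psi' mu f f' : 0 < s ->
  ground_state s lam psi psi' -> even_solution s mu f f' -> mu <= lam ->
  (mu = lam \/ forall x, f x = 0) /\ exists c, forall x, f x = c * psi x.
Proof.
move=> s0 [[_ per dpsi dpsi'] psi0] [_ fper df df'] le.
have sn : s != 0 by rewrite gt_eqF.
have pn x : psi x != 0 by rewrite gt_eqF.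
have p0 : 0 < 2 * pi :> R by rewrite mulr_gt0 // pi_gt0.
have dV := derV dpsi pn.
pose w x := psi' x / psi x.
have dw := derM dpsi' dV.
have dW := derB (derM dw (derM df df)) (derM df df').
pose W' x := - (f' x - w x * f x) ^+ 2 + (mu - lam) / s * f x ^+ 2.
have {}dW : der (fun x => w x * (f x * f x) - f x * f' x) W'.
  by apply: der_eq dW _ => x; rewrite /W' /w; field; rewrite sn pn.
have ms : (mu - lam) / s <= 0 by rewrite pmulr_lle0 ?invr_gt0 // subr_le0.
have W'0 x : W' x = 0.
  apply: (periodic_nincr_cst p0 dW).
    move=> y; rewrite /w per fper (der_periodic dpsi per).
    by rewrite (der_periodic df fper).
  move=> y; rewrite /W'; have := sqr_ge0 (f' y - w y * f y).
  have : (mu - lam) / s * f y ^+ 2 <= 0 by rewrite mulr_le0_ge0 // sqr_ge0.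
  by lra.
have sq x : (f' x - w x * f x) ^+ 2 = 0 /\ (mu - lam) / s * f x ^+ 2 = 0.
  have := W'0 x; rewrite /W'; have := sqr_ge0 (f' x - w x * f x).
  have : (mu - lam) / s * f x ^+ 2 <= 0 by rewrite mulr_le0_ge0 // sqr_ge0.
  by move=> h1 h2 h3; split; lra.
split.
  have [->|ne] := eqVneq mu lam; first by left.
  right=> x; have /eqP := (sq x).2.
  rewrite mulf_eq0 sqrf_eq0 mulf_eq0 subr_eq0 (negbTE ne) invr_eq0 (negbTE sn) /=.
  by move/eqP.
have dq : der (fun x => f x / psi x) (fun=> 0).
  apply: der_eq (derM df dV) _ => x.
  have /eqP := (sq x).1; rewrite sqrf_eq0 subr_eq0 => /eqP ->.
  by rewrite /w; field; rewrite pn.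
exists (f 0 / psi 0) => x.
by rewrite -(der0_cst dq x 0) divfK.
Qed.

(** By [ground_state_comparison] an even periodic solution for a smaller value vanishes identically,
    so the infimum defining [a0] is attained at the positive solution. *)
Lemma ground_state_a0 s lam psi psi' : 0 < s -> ground_state s lam psi psi' ->
  a0 (- (2 / s)) = 4 * lam / s.
Proof.
move=> s0 gs; have sn : s != 0 by rewrite gt_eqF.
have mem : mathieu_char_even (- (2 / s)) (4 * lam / s).
  exists (fun x => psi (2 * x)); apply: even_solution_mathieu gs.1 _ => //.
  by exists 0; rewrite gt_eqF ?gs.2.
have lb : lbound (mathieu_char_even (- (2 / s))) (4 * lam / s).
  move=> b [z hz]; have [f' hf] := mathieu_even_solution s0 hz.
  rewrite leNgt; apply/negP => lt.
  have lt' : s * b / 4 < lam.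
    by move: lt; rewrite ltr_pdivlMr //; lra.
  have [[e|f0] _] := ground_state_comparison s0 gs hf (ltW lt').
    by rewrite e ltxx in lt'.
  have [[x0 /eqP zx0] _] := hz; apply: zx0.
  by rewrite -(f0 (x0 * 2)) mulfK.
apply/eqP; rewrite eq_le; apply/andP; split.
  by apply: ge_inf => //; exists (4 * lam / s).
by apply: lb_le_inf => //; exists (4 * lam / s).
Qed.

(** Whatever eigenfunction is chosen as ce_0, it is a multiple of the positive one; this lets the
    characterization of minimizers quantify over all of them. *)
Lemma ground_state_ce0 s lam psi psi' (z : R -> R) : 0 < s -> ground_state s lam psi psi' ->
  is_ce0 (- (2 / s)) z -> exists c, forall x, z x = c * psi (2 * x).
Proof.
move=> s0 gs; rewrite /is_ce0 (ground_state_a0 s0 gs) => hy.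
have [f' hf] := mathieu_even_solution s0 hy.
have e : s * (4 * lam / s) / 4 = lam by field; rewrite gt_eqF.
rewrite e in hf.
have [_ [c hc]] := ground_state_comparison s0 gs hf (lexx _).
by exists c => x; rewrite -hc [2 * x]mulrC mulfK.
Qed.

Lemma ce0_ground_state s lam psi psi' : 0 < s -> ground_state s lam psi psi' ->
  is_ce0 (- (2 / s)) (fun x => psi (2 * x)).
Proof.
move=> s0 gs; rewrite /is_ce0 (ground_state_a0 s0 gs).
apply: even_solution_mathieu gs.1 _ => //.
by exists 0; rewrite gt_eqF ?gs.2.
Qed.

(** * Shooting on the half period from 0 to pi *)

Section Shooting.
Variable s : R.
Hypothesis s0 : 0 < s.

Let V a x := - ((a + cos x) / s).
Let bd a := (`|a| + 1) / s + 1.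

Let bd1 a : 1 <= bd a.
Proof. by rewrite /bd lerDr divr_ge0 ?addr_ge0 // ltW. Qed.

Let Vbd a x : `|V a x| <= bd a.
Proof.
rewrite /V normrN normrM [X in _ * X]ger0_norm ?invr_ge0 ?(ltW s0) //.
apply: le_trans (_ : (`|a| + 1) / s <= _); last by rewrite /bd lerDl.
rewrite ler_pM2r ?invr_gt0 //; apply: le_trans (ler_normD _ _) _.
by rewrite lerD2l cos_max.
Qed.

Let cV a : continuous (V a).
Proof.
apply: der_continuous (der_ext (derZ (- s^-1) (derD (der_cst a) (@der_cos R))) _) => x.
by rewrite /V mulNr mulrC.
Qed.

Let shooting_solutions : exists y z : R -> R -> R, forall a,
  [/\ der (y a) (z a), der (z a) (fun x => V a x * y a x), y a 0 = 1 & z a 0 = 0].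
Proof.
have /choice[p hp] a : exists p : (R -> R) * (R -> R),
    [/\ der p.1 p.2, der p.2 (fun x => V a x * p.1 x), p.1 0 = 1 & p.2 0 = 0].
  have [P [Q h]] := linear_ivp (@cV a) (bd1 a) (@Vbd a); by exists (P, Q).
by exists (fun a => (p a).1), (fun a => (p a).2) => a; exact: hp.
Qed.

(** The cosine is symmetric about 0 and about pi. An even solution with zero slope at pi is
    therefore symmetric about pi as well, hence [2 pi]-periodic, and positivity on the half period
    spreads to the line. *)
Lemma ground_state_exists : exists lam psi psi', ground_state s lam psi psi'.
Proof.
have [y [z yz]] := shooting_solutions.
have dy a : der (y a) (z a) by case: (yz a).
have dz a : der (z a) (fun x => V a x * y a x) by case: (yz a).
have y0 a : y a 0 = 1 by case: (yz a).
have z0 a : z a 0 = 0 by case: (yz a).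
have pp : 0 < pi :> R by exact: pi_gt0.
(* Lipschitz dependence on the parameter near [a]: the difference of two solutions obeys the
   equation for [b] with source [(a - b) / s * y a], and [M] bounds the potential for all [b] within
   distance 1. *)
have lip a : exists2 C, 0 < C & forall b, `|b - a| <= 1 -> forall x, 0 <= x <= pi ->
    `|y b x - y a x| <= C * `|b - a| /\ `|z b x - z a x| <= C * `|b - a|.
  have cy : continuous (fun x => `|y a x|).
    by move=> x; apply: cvg_norm; exact: der_continuous (dy a) x.
  have [c _ hc] := EVT_max (ltW pp) (within_cts cy).
  pose M := (`|a| + 2) / s.
  have M0 : 0 <= M by rewrite divr_ge0 ?addr_ge0 // ltW.
  pose Y := `|y a c| + 1.
  have Y0 : 0 < Y by rewrite /Y ltr_wpDl.
  exists (Y / s * expR ((M + 2) * pi)); first by rewrite !mulr_gt0 ?invr_gt0 ?expR_gt0.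
  move=> b ba x /andP[x0 xpi].
  have dD := derB (dy b) (dy a); have dD1 := derB (dz b) (dz a).
  pose e := `|b - a| * (Y / s).
  have e0 : 0 <= e by rewrite /e !mulr_ge0 ?invr_ge0 // ltW.
  have := @gronwall R _ _ _ M e 0 x dD dD1 M0 _ _ _ x0.
  rewrite !y0 !z0 !subrr => /(_ _ erefl erefl) h.
  have {h} h : (y b x - y a x) ^+ 2 + (z b x - z a x) ^+ 2 <=
      (e * expR ((M + 2) * pi)) ^+ 2.
    apply: le_trans (h _) _.
      move=> t /andP[t0 tx].
      have -> : V b t * y b t - V a t * y a t = V b t * (y b t - y a t) + (a - b) / s * y a t.
        by rewrite /V; field; rewrite gt_eqF.
      apply: le_trans (ler_normD _ _) _; rewrite !normrM; apply: lerD.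
        rewrite ler_wpM2r // /V /M normrN normrM [X in _ * X]ger0_norm ?invr_ge0 ?(ltW s0) //.
        rewrite ler_pM2r ?invr_gt0 //; apply: le_trans (ler_normD _ _) _.
        have := cos_max t; have := ler_normD (b - a) a; rewrite subrK; lra.
      rewrite [X in _ * X * _]ger0_norm ?invr_ge0 ?(ltW s0) // distrC /e -mulrA.
      rewrite ler_wpM2l // mulrC ler_wpM2r ?invr_ge0 ?(ltW s0) // /Y.
      have := hc t; rewrite in_itv /= (ltW t0) (ltW (lt_le_trans tx xpi)) => /(_ isT).
      by lra.
    rewrite subr0 [X in _ <= X]exprMn ler_wpM2l ?sqr_ge0 // expr2 -expRD ler_expR.
    rewrite -mulrDr ler_wpM2l ?addr_ge0 //; lra.
  have B0 : 0 <= e * expR ((M + 2) * pi) by rewrite mulr_ge0 // expR_ge0.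
  have eE : e * expR ((M + 2) * pi) = Y / s * expR ((M + 2) * pi) * `|b - a|.
    by rewrite /e; ring.
  rewrite -eE; split; rewrite -(ger0_norm B0) -ler_sqr ?nnegrE // !real_normK ?num_real //.
    by have := sqr_ge0 (z b x - z a x); lra.
  by have := sqr_ge0 (y b x - y a x); lra.
pose A := [set a | (forall x, 0 <= x <= pi -> 0 < y a x) /\ 0 < z a pi].
(* Here the potential is at least [1 / s], so [y z] and then [y^2] increase from their values at 0;
   thus [y] stays at least 1 and its slope grows. *)
have A2 : A (- 2).
  pose a : R := - 2.
  have Vpos x : s^-1 <= V a x.
    rewrite /V -mulNr -[X in X <= _]mul1r ler_pM2r ?invr_gt0 // /a.
    by have := cos_le1 x; lra.
  have Vpos0 x : 0 <= V a x by apply: le_trans (Vpos x); rewrite invr_ge0 ltW.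
  have yz0 x : 0 <= x -> 0 <= y a x * z a x.
    move=> x0; have P t : 0 < t < x -> 0 <= z a t * z a t + y a t * (V a t * y a t).
      by move=> _; rewrite mulrCA -!expr2 addr_ge0 ?sqr_ge0 // mulr_ge0 ?sqr_ge0.
    by have := der_ge0_ndecr (derM (dy a) (dz a)) P x0; rewrite z0 mulr0.
  have y1 x : 0 <= x -> 1 <= y a x * y a x.
    move=> x0; have P t : 0 < t < x -> 0 <= z a t * y a t + y a t * z a t.
      by move=> /andP[/ltW/yz0 ? _]; rewrite mulrC addr_ge0.
    by have := der_ge0_ndecr (derM (dy a) (dy a)) P x0; rewrite y0 mulr1.
  have yp x : 0 <= x -> 0 < y a x.
    move=> x0; rewrite ltNge; apply/negP => yx.
    have [||c] := @IVT R (y a) 0 x 0 x0.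
    - exact/within_cts/der_continuous/dy.
    - by rewrite y0 ge_min yx orbT le_max ler01.
    rewrite in_itv /= => /andP[c0 _] yc; have := y1 c c0.
    by rewrite yc mulr0; lra.
  split; first by move=> x /andP[/yp].
  have P t : 0 < t < pi -> s^-1 * 1 <= V a t * y a t.
    move=> /andP[/ltW t0 _]; apply: ler_pM => //; first by rewrite invr_ge0 ltW.
    by have := y1 t t0; have := yp t t0; nra.
  have := der_le (derZ s^-1 (@der_id R)) (dz a) P (ltW pp).
  by rewrite z0 mulr0 !subr0; apply: lt_le_trans; rewrite mulr_gt0 ?invr_gt0.
(* For [a > 1] a positive solution is concave, so its slope cannot become positive. *)
have A1 : ubound A 1.
  move=> a [ya za]; rewrite leNgt; apply/negP => a1.
  have P t : 0 < t < pi -> V a t * y a t <= 0.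
    move=> /andP[t0 tpi]; rewrite /V mulNr oppr_le0 mulr_ge0 ?divr_ge0 ?(ltW s0) //.
      by have := cos_geN1 t; lra.
    by rewrite ltW // ya // (ltW t0) (ltW tpi).
  by have := der_le0_nincr (dz a) P (ltW pp); rewrite z0 leNgt za.
have hsA : has_sup A by split; [exists (-2)|exists 1].
pose a := sup A.
have [C C0 hC] := lip a.
have approx e : 0 < e -> exists2 b, A b & `|b - a| < e.
  move=> e0; have [b Ab hb] := sup_adherent e0 hsA.
  exists b => //; have := ub_le_sup hsA.2 Ab; rewrite -/a => ba.
  by rewrite ltr_norml; apply/andP; split; move: hb; rewrite -/a; lra.
have approxC e : 0 < e -> exists2 b, A b & (`|b - a| <= 1 /\ C * `|b - a| < e).
  move=> e0; have m0 : 0 < Num.min 1 (e / C) by rewrite lt_min ltr01 divr_gt0.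
  have [b Ab] := approx _ m0; rewrite lt_min => /andP[/ltW h1 h2].
  by exists b => //; split => //; rewrite mulrC -ltr_pdivlMr.
have yge x : 0 <= x <= pi -> 0 <= y a x.
  move=> xpi; rewrite leNgt; apply/negP => yx.
  have ny : 0 < - y a x by lra.
  have [b [Ab _] [h1 h2]] := approxC _ ny.
  have [+ _] := hC b h1 x xpi; have := Ab x xpi.
  by rewrite ler_norml => ? /andP[]; lra.
have zge : 0 <= z a pi.
  rewrite leNgt; apply/negP => zx.
  have nz : 0 < - z a pi by lra.
  have [b [_ Ab] [h1 h2]] := approxC _ nz.
  have pin : 0 <= (pi : R) <= pi by rewrite (ltW pp) lexx.
  have [_] := hC b h1 pi pin.
  by rewrite ler_norml => /andP[]; lra.
have nodouble x : y a x = 0 -> z a x = 0 -> False.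
  move=> yx zx; have := linear_ivp_unique (dy a) (dz a) (@Vbd a) yx zx 0.
  by rewrite y0 => /eqP; rewrite oner_eq0.
(* A zero inside the interval would be a minimum of the nonnegative [y a], hence a double zero,
   which uniqueness excludes. *)
have ypos_lt x : 0 <= x < pi -> 0 < y a x.
  move=> /andP[x0 xlt]; have xpi : 0 <= x <= pi by rewrite x0 ltW.
  rewrite lt_def yge // andbT; apply/eqP => yx.
  have {}x0 : 0 < x.
    by rewrite lt_def x0 andbT; apply/eqP => xe; move: yx; rewrite xe y0 => /eqP; rewrite oner_eq0.
  apply: (nodouble x yx).
  have e1 t : t \in `]0, pi[%R -> derivable (y a) t 1 by move=> _; exact: der_derivable (dy a).
  have e2 : x \in `]0, pi[%R by rewrite in_itv /= x0.
  have e3 t : t \in `]0, pi[%R -> y a x <= y a t.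
    by rewrite in_itv /= => /andP[t0 tp]; rewrite yx yge // !ltW.
  have h := derive1_at_min (ltW pp) e1 e2 e3; have h' := dy a x.
  by rewrite -(@derive_val _ _ _ _ _ _ _ h') (@derive_val _ _ _ _ _ _ _ h).
(* A zero at the end point is not double, so the slope there is positive; then [y a] increases up to
   the value 0 and is nonpositive just before pi. *)
have ypi : 0 < y a pi.
  rewrite lt_def yge ?lexx ?(ltW pp) // andbT; apply/eqP => yx.
  have zp : 0 < z a pi.
    by rewrite lt_def zge andbT; apply/eqP => zx; exact: (nodouble pi).
  have [d /= d0 hd] : exists2 d, 0 < d & forall t, `|pi - t| < d -> 0 < z a t.
    have /cvgr_dist_lt/(_ _ zp) := @der_continuous _ _ _ (dz a) pi.
    move=> /nbhs_ballP[d /= d0 hd]; exists d => // t /hd.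
    by rewrite ltr_norml => /andP[]; lra.
  pose t := Num.max (pi - d / 2) (pi / 2).
  have t1 : pi - d / 2 <= t by rewrite /t le_max lexx.
  have t2 : pi / 2 <= t by rewrite /t le_max lexx orbT.
  have t3 : t < pi by rewrite /t gt_max; apply/andP; split; lra.
  have : y a t <= y a pi.
    apply: (der_ge0_ndecr (dy a)); last exact: ltW.
    move=> r /andP[tr rpi]; apply/ltW/hd; rewrite ger0_norm; lra.
  by rewrite yx leNgt ypos_lt // t3 andbT; lra.
have ypos x : 0 <= x <= pi -> 0 < y a x.
  by move=> /andP[x0]; rewrite le_eqVlt => /predU1P[->//|xp]; rewrite ypos_lt ?x0.
(* With a positive slope at pi both defining conditions of [A] hold with the margin [m], so a
   slightly larger parameter would still belong to [A]. *)
have zpi : z a pi = 0.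
  apply/eqP; rewrite eq_le zge andbT leNgt; apply/negP => zp.
  have [c cpi hc] := EVT_min (ltW pp) (within_cts (der_continuous (dy a))).
  rewrite in_itv /= in cpi.
  pose m := Num.min (y a c) (z a pi).
  have m0 : 0 < m by rewrite /m lt_min ypos.
  pose b := a + Num.min 1 (m / C / 2).
  have dm : 0 < Num.min 1 (m / C / 2) by rewrite lt_min ltr01 !divr_gt0.
  have ba : `|b - a| = Num.min 1 (m / C / 2) by rewrite /b addrAC subrr add0r gtr0_norm.
  have b1 : `|b - a| <= 1 by rewrite ba ge_min lexx.
  have bm : C * `|b - a| < m.
    have : `|b - a| <= m / C / 2 by rewrite ba ge_min lexx orbT.
    rewrite -(ler_pM2l C0) => /le_lt_trans; apply.
    have -> : C * (m / C / 2) = m / 2 by field; rewrite gt_eqF.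
    by lra.
  have Ab : A b.
    split.
      move=> x xpi; have [+ _] := hC b b1 x xpi.
      have := hc x; rewrite in_itv /= => /(_ xpi).
      have : m <= y a c by rewrite /m ge_min lexx.
      by rewrite ler_norml => ? ? /andP[]; lra.
    have pin : 0 <= (pi : R) <= pi by rewrite (ltW pp) lexx.
    have [_] := hC b b1 pi pin.
    have : m <= z a pi by rewrite /m ge_min lexx orbT.
    by rewrite ler_norml => ? /andP[]; lra.
  by have := ub_le_sup hsA.2 Ab; rewrite -/a /b; lra.
(* Reflection about [k = c / 2]: the reflected solution has the same value and, as the slope
   vanishes at [k], the same slope there. It is used about 0 and about pi. *)
have refl c k : (forall x, cos (c - x) = cos x) -> c = 2 * k -> z a k = 0 ->
    forall x, y a (c - x) = y a x.
  move=> cc ck zk x.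
  have dr : der (fun x => c - x) (fun=> - 1 : R).
    by apply: der_eq (derB (der_cst c) (@der_id R)) _ => t; rewrite sub0r.
  have d1 := derB (der_comp (dy a) dr) (dy a).
  have d2 := derB (derZ (- 1) (der_comp (dz a) dr)) (dz a).
  apply/eqP; rewrite -subr_eq0; apply/eqP.
  apply: (linear_ivp_unique (V := V a) (x0 := k) d1 _ (@Vbd a)).
  - by apply: der_ext (der_eq d2 _) _ => t; rewrite /V ?cc; ring.
  - by have -> : c - k = k by [rewrite ck; ring]; rewrite subrr.
  - by have -> : c - k = k by [rewrite ck; ring]; rewrite zk mul0r subrr.
have ev x : y a (- x) = y a x.
  by rewrite -[LHS]/(y a (- x)) -sub0r (refl 0 0) ?mulr0 // => t; rewrite sub0r cosN.
have per x : y a (x + 2 * pi) = y a x.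
  rewrite -[RHS]ev -(refl (2 * pi) pi) ?zpi //; first by congr (y a _); ring.
  by move=> t; rewrite -cosN opprB mulr_natl -(cosD2pi (t - _)) subrK.
exists a, (y a), (z a); split; first by split.
move=> x; have [k h1 h2] := reduce_2pi x.
rewrite -(periodic_int per k); set t := x + _ in h1 h2 *.
have [t0|/ltW t0] := leP 0 t; first by rewrite ypos ?t0.
by rewrite -ev ypos //; apply/andP; split; lra.
Qed.

End Shooting.

End GroundState.

(** * Absolutely continuous functions *)

Section IntervalIntegral.
Variable R : realType.
Implicit Types (f g h : R -> R) (x y a b c d k : R).
Local Notation leb := (@lebesgue_measure R).

Definition itv_integrable a b f := leb.-integrable `[a, b] (EFin \o f).
Definition itv_int a b f : R := \int[leb]_(t in `[a, b]) f t.

Lemma itv_integrable_ext a b f g : {in `[a, b]%R, f =1 g} ->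
  itv_integrable a b f -> itv_integrable a b g.
Proof.
move=> fg; apply: eq_integrable => //= x; rewrite inE /= => xab.
by congr EFin; apply: fg.
Qed.

Lemma itv_integrable_cts a b f : {within `[a, b], continuous f} -> itv_integrable a b f.
Proof. by move=> cf; apply: continuous_compact_integrable => //; exact: segment_compact. Qed.

Lemma itv_integrable_cst a b c : itv_integrable a b (fun=> c).
Proof. by apply/itv_integrable_cts/within_cts => x; exact: cvg_cst. Qed.

Lemma itv_integrableD a b f g : itv_integrable a b f -> itv_integrable a b g ->
  itv_integrable a b (fun x => f x + g x).
Proof. by move=> hf hg; apply: (integrableD _ hf hg). Qed.

Lemma itv_integrableB a b f g : itv_integrable a b f -> itv_integrable a b g ->
  itv_integrable a b (fun x => f x - g x).
Proof. by move=> hf hg; apply: (integrableB _ hf hg). Qed.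

Lemma itv_integrableZ a b k f : itv_integrable a b f ->
  itv_integrable a b (fun x => k * f x).
Proof. by move=> hf; apply: (integrableZl _ k hf). Qed.

Lemma itv_integrable_norm a b f : itv_integrable a b f ->
  itv_integrable a b (fun x => `|f x|).
Proof. exact: integrable_norm. Qed.

Lemma itv_integrableS a b c d f : a <= c -> d <= b ->
  itv_integrable a b f -> itv_integrable c d f.
Proof.
move=> ac db; apply: integrableS => //; apply: subset_itvScc; rewrite bnd_simp //.
Qed.

Lemma itv_int_ext a b f g : {in `[a, b]%R, f =1 g} -> itv_int a b f = itv_int a b g.
Proof. by move=> fg; apply: eq_Rintegral => x; rewrite inE /=; exact: fg. Qed.

Lemma itv_intD a b f g : itv_integrable a b f -> itv_integrable a b g ->
  itv_int a b (fun x => f x + g x) = itv_int a b f + itv_int a b g.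
Proof. by move=> hf hg; exact: RintegralD. Qed.

Lemma itv_intB a b f g : itv_integrable a b f -> itv_integrable a b g ->
  itv_int a b (fun x => f x - g x) = itv_int a b f - itv_int a b g.
Proof. by move=> hf hg; exact: RintegralB. Qed.

Lemma itv_intZ a b k f : itv_integrable a b f ->
  itv_int a b (fun x => k * f x) = k * itv_int a b f.
Proof. by move=> hf; exact: RintegralZl. Qed.

Lemma itv_int_le a b f g : itv_integrable a b f -> itv_integrable a b g ->
  {in `[a, b]%R, forall x, f x <= g x} -> itv_int a b f <= itv_int a b g.
Proof. by move=> hf hg fg; apply: le_Rintegral => // x; exact: fg. Qed.

Lemma itv_int_norm a b f : itv_integrable a b f ->
  `|itv_int a b f| <= itv_int a b (fun x => `|f x|).
Proof. by move=> hf; apply: le_normr_Rintegral. Qed.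

Lemma itv_int_cst a b c : a <= b -> itv_int a b (fun=> c) = c * (b - a).
Proof.
move=> ab; rewrite /itv_int Rintegral_cst //; congr (_ * _).
have h : (leb `[a, b]%classic = (b - a)%:E)%E.
  rewrite lebesgue_measure_itv /= lte_fin.
  by move: ab; rewrite le_eqVlt => /predU1P[->|->]; rewrite ?ltxx ?subrr.
by rewrite -[RHS]/(fine (b - a)%:E); congr fine; exact: h.
Qed.

Lemma itv_int0 a b : itv_int a b (fun=> 0) = 0.
Proof. by rewrite /itv_int Rintegral_cst // mul0r. Qed.

Lemma itv_int_ge0 a b f : {in `[a, b]%R, forall x, 0 <= f x} -> 0 <= itv_int a b f.
Proof. by move=> h; apply: Rintegral_ge0 => x; exact: h. Qed.

Lemma itv_int_cat a b c f : a <= b -> b <= c -> itv_integrable a c f ->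
  itv_int a c f = itv_int a b f + itv_int b c f.
Proof.
move=> ab bc hf; apply/eqP; rewrite addrC -subr_eq; apply/eqP.
rewrite /itv_int (@Rintegral_itvB _ f (BLeft a) (BRight c) b) //.
rewrite Rintegral_itv_obnd_cbnd //.
apply: integrableS (itv_integrableS ab (lexx c) hf) => //.
by apply: subset_itvr; rewrite bnd_simp.
Qed.

Definition itv_sq_integrable a b f :=
  measurable_fun `[a, b] f /\ leb.-integrable `[a, b] (fun x => ((f x) ^+ 2)%:E).

Lemma itv_sq_integrableM a b f g : itv_sq_integrable a b f -> itv_sq_integrable a b g ->
  itv_integrable a b (fun x => f x * g x).
Proof.
move=> [mf hf] [mg hg].
apply: (le_integrable _ _ _ (itv_integrableD (f := fun x => f x ^+ 2) (g := fun x => g x ^+ 2) hf hg)) => //.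
  by apply/measurable_EFinP; apply: measurable_funM.
move=> x _ /=; rewrite lee_fin [X in _ <= X]ger0_norm ?addr_ge0 ?sqr_ge0 //.
have := sqr_ge0 (f x - g x); have := sqr_ge0 (f x + g x).
have := sqr_ge0 (f x); have := sqr_ge0 (g x).
by rewrite ler_norml => ? ? ? ?; apply/andP; split; nra.
Qed.

Lemma itv_sq_integrable_cts a b f : {within `[a, b], continuous f} -> itv_sq_integrable a b f.
Proof.
move=> cf; split; first exact: subspace_continuous_measurable_fun.
apply: (@itv_integrable_cts _ _ (fun x => f x ^+ 2)) => x.
by exact: (cvgM (cf x) (cf x)).
Qed.

Lemma itv_sq_integrableW a b f : itv_sq_integrable a b f -> itv_integrable a b f.
Proof.
move=> hf; have h1 : itv_sq_integrable a b (fun=> 1).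
  by apply/itv_sq_integrable_cts/within_cts => x; exact: cvg_cst.
by apply: itv_integrable_ext (itv_sq_integrableM hf h1) => x _; rewrite mulr1.
Qed.

Lemma itv_sq_integrable_sq a b f : itv_sq_integrable a b f ->
  itv_integrable a b (fun x => f x ^+ 2).
Proof. by case. Qed.

Lemma itv_sq_integrableD a b f g : itv_sq_integrable a b f -> itv_sq_integrable a b g ->
  itv_sq_integrable a b (fun x => f x + g x).
Proof.
move=> hf hg; split; first by apply: measurable_funD; [exact: hf.1|exact: hg.1].
have := itv_integrableD (itv_integrableD (itv_sq_integrable_sq hf) (itv_sq_integrable_sq hg))
  (itv_integrableZ 2 (itv_sq_integrableM hf hg)).
by apply: itv_integrable_ext => x _; ring.
Qed.

Lemma itv_sq_integrableMc a b (c : R -> R) f : {within `[a, b], continuous c} ->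
  itv_sq_integrable a b f -> itv_sq_integrable a b (fun x => c x * f x).
Proof.
move=> cc hf; have hc := itv_sq_integrable_cts cc.
have mcf : measurable_fun `[a, b] (fun x => c x * f x).
  by apply: measurable_funM; [exact: hc.1|exact: hf.1].
split => //.
have /compact_bounded[M [_ hM]] := continuous_compact cc (@segment_compact _ a b).
have {}hM x : x \in `[a, b]%R -> `|c x| <= `|M| + 1.
  by move=> xab; apply: hM; [rewrite ltr_pwDr // ler_norm|exists x].
apply: (le_integrable _ _ _ (itv_integrableZ ((`|M| + 1) ^+ 2) (itv_sq_integrable_sq hf))) => //.
  by apply/measurable_EFinP; apply: measurable_funX.
move=> x xab.
have k0 : 0 <= (`|M| + 1) ^+ 2 * f x ^+ 2 by rewrite mulr_ge0 ?sqr_ge0.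
move=> /=; rewrite lee_fin (ger0_norm (sqr_ge0 _)) (ger0_norm k0) exprMn.
rewrite ler_wpM2r ?sqr_ge0 // -[c x ^+ 2]real_normK ?num_real //.
by rewrite ler_sqr ?nnegrE ?addr_ge0 //; exact: hM.
Qed.

Lemma itv_sq_integrableZ a b k f : itv_sq_integrable a b f ->
  itv_sq_integrable a b (fun x => k * f x).
Proof. by apply: itv_sq_integrableMc; apply: within_cts => x; exact: cvg_cst. Qed.

Lemma itv_sq_integrableB a b f g : itv_sq_integrable a b f -> itv_sq_integrable a b g ->
  itv_sq_integrable a b (fun x => f x - g x).
Proof.
move=> hf hg; have := itv_sq_integrableD hf (itv_sq_integrableZ (- 1) hg).
by under [X in _ _ _ X -> _]eq_fun do rewrite mulN1r.
Qed.

Lemma itv_sq_integrableS a b c d f : a <= c -> d <= b ->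
  itv_sq_integrable a b f -> itv_sq_integrable c d f.
Proof.
move=> ac db [mf hf]; split; last exact: (@itv_integrableS a b c d (fun x => f x ^+ 2)).
by apply: measurable_funS mf => //; apply: subset_itvScc; rewrite bnd_simp //.
Qed.

(** Expand the integral of [(|f| - c)^2] with [c] the mean of [|f|]; a mean requires [a < b], hence
    the separate degenerate case. *)
Lemma itv_cauchy_schwarz a b f : a <= b -> itv_sq_integrable a b f ->
  itv_int a b (fun x => `|f x|) ^+ 2 <= (b - a) * itv_int a b (fun x => f x ^+ 2).
Proof.
rewrite le_eqVlt => /predU1P[<-|ab] hf.
  by rewrite subrr mul0r /itv_int set_itv1 Rintegral_set1 expr0n.
set A := itv_int _ _ _; set B := itv_int _ _ _.
have ba : 0 < b - a by lra.
have [c e] : exists c, A = c * (b - a) by exists (A / (b - a)); rewrite divfK // gt_eqF.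
have i1 := itv_integrable_norm (itv_sq_integrableW hf).
have i2 := itv_sq_integrable_sq hf.
have : 0 <= itv_int a b (fun x => (f x ^+ 2 - 2 * c * `|f x|) + c ^+ 2).
  apply: itv_int_ge0 => x _; rewrite -[f x ^+ 2]real_normK ?num_real //.
  have := sqr_ge0 (`|f x| - c); lra.
have i3 := itv_integrableZ (2 * c) i1.
rewrite (itv_intD (itv_integrableB i2 i3) (itv_integrable_cst _ _ _)).
rewrite (itv_intB i2 i3) (itv_intZ _ i1) (itv_int_cst _ (ltW ab)) -/A -/B => h.
have h2 := mulr_ge0 (ltW ba) h; rewrite -subr_ge0 e; move: h2; rewrite e.
by congr (is_true (0 <= _)); ring.
Qed.

Definition abs_cts a b F f := itv_sq_integrable a b f /\
  forall x, x \in `[a, b]%R -> F x = F a + itv_int a x f.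

Lemma abs_cts_itv a b F f x y : abs_cts a b F f -> a <= x -> x <= y -> y <= b ->
  F y - F x = itv_int x y f.
Proof.
move=> [hf hF] ax xy yb.
rewrite (hF y) ?in_itv /= ?yb ?(le_trans ax) // (hF x) ?in_itv /= ?ax ?(le_trans xy) //.
rewrite (itv_int_cat ax xy); first by ring.
exact: itv_integrableS (itv_sq_integrableW hf).
Qed.

Lemma abs_cts_within a b F f : a <= b -> abs_cts a b F f -> {within `[a, b], continuous F}.
Proof.
move=> ab [hf hF].
have : {within `[a, b], continuous (fun x => F a + itv_int a x f)}.
  have := @parameterized_integral_continuous R a b f ab (itv_sq_integrableW hf).
  by move=> h x; apply: cvgD; [exact: cvg_cst|exact: h].
apply: subspace_eq_continuous => x; rewrite inE /= => xab.
exact/esym/hF.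
Qed.

(** The increments are of second order: over [2^n] equal pieces the bounds telescope to
    [(b - a) (A b - A a) / 2^n], for every n. *)
Lemma uniform_partition_cst (D A : R -> R) a b : a <= b ->
  (forall x y, a <= x -> x <= y -> y <= b -> `|D y - D x| <= (y - x) * (A y - A x)) ->
  D b = D a.
Proof.
move=> ab h; apply/eqP; rewrite -subr_eq0; apply/eqP.
apply: (@half_power_eq0 _ _ ((b - a) * (A b - A a))) => n.
have N0 : (0 : R) < 2 ^+ n by rewrite exprn_gt0.
pose d := (b - a) / 2 ^+ n.
have d0 : 0 <= d by rewrite divr_ge0 ?subr_ge0 // ltW.
have dn : (2 ^ n)%:R * d = b - a by rewrite /d natrX mulrC divfK // gt_eqF.
have step m : (m <= 2 ^ n)%N ->
    `|D (a + m%:R * d) - D a| <= d * (A (a + m%:R * d) - A a).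
  elim: m => [_|m IH mn]; first by rewrite mul0r addr0 !subrr normr0 mulr0.
  have h1 := IH (ltnW mn).
  have m0 : 0 <= m%:R * d by rewrite mulr_ge0.
  have ms : m.+1%:R * d = m%:R * d + d by rewrite -natr1 mulrDl mul1r.
  have mb : m.+1%:R * d <= b - a by rewrite -dn ler_wpM2r // ler_nat.
  have p1 : a <= a + m%:R * d by lra.
  have p2 : a + m%:R * d <= a + m.+1%:R * d by lra.
  have p3 : a + m.+1%:R * d <= b by lra.
  have h2 := h _ _ p1 p2 p3.
  have e : a + m.+1%:R * d - (a + m%:R * d) = d by rewrite ms; ring.
  rewrite e in h2.
  have -> : D (a + m.+1%:R * d) - D a =
    (D (a + m.+1%:R * d) - D (a + m%:R * d)) + (D (a + m%:R * d) - D a) by ring.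
  by apply: le_trans (ler_normD _ _) _; lra.
have eb : a + (b - a) = b by ring.
have := step _ (leqnn _); rewrite dn eb => /le_trans; apply.
by rewrite /d mulrAC.
Qed.

(* The increments of the difference of both sides over [x, y] are at most
   [(y - x) * (A y - A x)], where [A] is a primitive of [f^2 + h^2]. *)
Lemma abs_ctsM a b F f H h : a <= b -> abs_cts a b F f -> abs_cts a b H h ->
  abs_cts a b (fun x => F x * H x) (fun x => f x * H x + F x * h x).
Proof.
move=> ab hF hH; have [hf _] := hF; have [hh _] := hH.
have cF := abs_cts_within ab hF; have cH := abs_cts_within ab hH.
pose k x := f x * H x + F x * h x.
have hk : itv_sq_integrable a b k.
  apply: itv_sq_integrableD; last exact: itv_sq_integrableMc.
  under eq_fun do rewrite mulrC; exact: itv_sq_integrableMc.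
split=> // x; rewrite in_itv /= => /andP[ax xb].
pose D t := F t * H t - itv_int a t k.
pose q t := f t ^+ 2 + h t ^+ 2.
have iq : itv_integrable a b q.
  by apply: itv_integrableD; exact: itv_sq_integrable_sq.
suff : D x = D a.
  rewrite /D => /eqP; rewrite subr_eq => /eqP ->.
  by rewrite [itv_int a a k]/itv_int set_itv1 Rintegral_set1 subr0.
apply: (@uniform_partition_cst _ (fun t => itv_int a t q)) => // s t as_ st tx.
have tb := le_trans tx xb.
have at_ := le_trans as_ st.
have sb := le_trans st tb.
have S1 := itv_sq_integrableS as_ tb hf; have S2 := itv_sq_integrableS as_ tb hh.
have qE : itv_int a t q - itv_int a s q = itv_int s t (fun x => f x ^+ 2) + itv_int s t (fun x => h x ^+ 2).
  rewrite (itv_int_cat as_ st (itv_integrableS (lexx _) tb iq)) addrC addKr.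
  by rewrite itv_intD //; exact: itv_sq_integrable_sq.
have kE : itv_int a t k - itv_int a s k = itv_int s t k.
  rewrite (itv_int_cat as_ st) ?(addrC (itv_int a s k)) ?addrK //.
  exact: itv_integrableS (lexx _) tb (itv_sq_integrableW hk).
have i1 := itv_sq_integrableW S1; have i2 := itv_sq_integrableW S2.
have ik : itv_integrable s t k by apply: itv_integrableS (itv_sq_integrableW hk).
have j1 := itv_integrableZ (H t) i1; have j2 := itv_integrableZ (F s) i2.
(* Splitting [F t H t - F s H s] as [H t (F t - F s) + F s (H t - H s)] leaves, after subtracting
   [k], only the oscillations [H t - H r] and [F r - F s] as coefficients. *)
have DE : D t - D s = itv_int s t (fun r => (H t * f r + F s * h r) - k r).
  rewrite (itv_intB (itv_integrableD j1 j2) ik) (itv_intD j1 j2).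
  rewrite (itv_intZ _ i1) (itv_intZ _ i2) -kE.
  rewrite -(abs_cts_itv hF as_ st tb) -(abs_cts_itv hH as_ st tb) /D; ring.
pose A := itv_int s t (fun r => `|f r|); pose B := itv_int s t (fun r => `|h r|).
have osc G g u v : abs_cts a b G g -> s <= u -> u <= v -> v <= t ->
    `|G v - G u| <= itv_int s t (fun r => `|g r|).
  move=> hG su uv vt; have := hG => -[hg _].
  have jg : itv_integrable s t (fun r => `|g r|).
    exact/itv_integrable_norm/(itv_integrableS as_ tb)/itv_sq_integrableW.
  rewrite (abs_cts_itv hG (le_trans as_ su) uv (le_trans vt tb)).
  apply: le_trans (itv_int_norm _) _.
    exact: itv_integrableS (le_trans as_ su) (le_trans vt tb) (itv_sq_integrableW hg).
  rewrite (itv_int_cat su (le_trans uv vt)) // (itv_int_cat uv vt); last exact: itv_integrableS jg.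
  have : 0 <= itv_int s u (fun r => `|g r|) by apply: itv_int_ge0.
  have : 0 <= itv_int v t (fun r => `|g r|) by apply: itv_int_ge0.
  lra.
(* Each oscillation is at most [B] or [A]. Then [2 A B <= A^2 + B^2], and Cauchy-Schwarz supplies
   the factor [t - s]. *)
have bound : `|D t - D s| <= 2 * (A * B).
  rewrite DE; apply: le_trans (itv_int_norm _) _.
    exact: itv_integrableB (itv_integrableD j1 j2) ik.
  have n1 := itv_integrableZ B (itv_integrable_norm i1).
  have n2 := itv_integrableZ A (itv_integrable_norm i2).
  have -> : 2 * (A * B) = itv_int s t (fun r => B * `|f r| + A * `|h r|).
    rewrite (itv_intD n1 n2) (itv_intZ _ (itv_integrable_norm i1)).
    by rewrite (itv_intZ _ (itv_integrable_norm i2)) -/A -/B; ring.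
  apply: itv_int_le.
  - apply: itv_integrable_norm.
    exact: itv_integrableB (itv_integrableD j1 j2) ik.
  - exact: itv_integrableD n1 n2.
  move=> r; rewrite in_itv /= => /andP[sr rt].
  have -> : H t * f r + F s * h r - k r = (H t - H r) * f r - (F r - F s) * h r.
    by rewrite /k; ring.
  apply: le_trans (ler_normB _ _) _; rewrite !normrM; apply: lerD.
    by rewrite ler_wpM2r //; exact: osc.
  by rewrite ler_wpM2r //; exact: osc.
apply: le_trans bound _; rewrite qE mulrDr.
have := itv_cauchy_schwarz st S1; have := itv_cauchy_schwarz st S2.
rewrite -/A -/B; have := sqr_ge0 (A - B).
by rewrite sqrrB mulr2n; lra.
Qed.

Lemma itv_int_FTC F f a b : a <= b -> der F f -> {within `[a, b], continuous f} ->
  itv_int a b f = F b - F a.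
Proof.
rewrite le_eqVlt => /predU1P[<- _ _|ab dF cf].
  by rewrite /itv_int set_itv1 Rintegral_set1 subrr.
rewrite /itv_int /Rintegral (@continuous_FTC2 _ f F a b) //.
- split.
  + by move=> x _; exact: der_derivable dF.
  + exact/cvg_at_right_filter/(@der_continuous _ _ _ dF).
  + exact/cvg_at_left_filter/(@der_continuous _ _ _ dF).
- by move=> x _; rewrite (der_derive1 dF).
Qed.

Lemma abs_cts_der a b F f : der F f -> continuous f -> abs_cts a b F f.
Proof.
move=> dF cf; split; first exact/itv_sq_integrable_cts/within_cts.
move=> x; rewrite in_itv /= => /andP[ax _].
by rewrite (itv_int_FTC ax dF (within_cts cf)); ring.
Qed.

(** [|f g| <= 2^n f^2 + 2^-n g^2], where the first term integrates to zero and n is arbitrary.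
    Functions vanishing only almost everywhere are thus handled through integrals. *)
Lemma itv_int_sq0 a b f g : itv_sq_integrable a b f -> itv_sq_integrable a b g ->
  itv_int a b (fun x => f x ^+ 2) = 0 -> forall x, x \in `[a, b]%R ->
  itv_int a x (fun t => f t * g t) = 0.
Proof.
move=> hf hg f0 x; rewrite in_itv /= => /andP[ax xb].
have hf' := itv_sq_integrableS (lexx a) xb hf; have hg' := itv_sq_integrableS (lexx a) xb hg.
have fx0 : itv_int a x (fun t => f t ^+ 2) = 0.
  have := f0; rewrite (itv_int_cat ax xb); last exact: itv_sq_integrable_sq.
  have : 0 <= itv_int a x (fun t => f t ^+ 2) by apply: itv_int_ge0 => t _; exact: sqr_ge0.
  have : 0 <= itv_int x b (fun t => f t ^+ 2) by apply: itv_int_ge0 => t _; exact: sqr_ge0.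
  lra.
apply: (@half_power_eq0 _ _ (itv_int a x (fun t => g t ^+ 2))) => n.
have N0 : (0 : R) < 2 ^+ n by rewrite exprn_gt0.
have ifg := itv_sq_integrableM hf' hg'.
apply: le_trans (itv_int_norm ifg) _.
have s1 := itv_integrableZ (2 ^+ n) (itv_sq_integrable_sq hf').
have s2 := itv_integrableZ (2 ^+ n)^-1 (itv_sq_integrable_sq hg').
have -> : itv_int a x (fun t => g t ^+ 2) / 2 ^+ n =
    itv_int a x (fun t => 2 ^+ n * f t ^+ 2 + (2 ^+ n)^-1 * g t ^+ 2).
  rewrite (itv_intD s1 s2) (itv_intZ _ (itv_sq_integrable_sq hf')) fx0 mulr0 add0r.
  by rewrite (itv_intZ _ (itv_sq_integrable_sq hg')) mulrC.
apply: itv_int_le.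
- exact: itv_integrable_norm.
- exact: itv_integrableD s1 s2.
move=> t _; rewrite normrM -[f t ^+ 2]real_normK ?num_real // -[g t ^+ 2]real_normK ?num_real //.
move: (normr_ge0 (f t)) (normr_ge0 (g t)); move: `|f t| `|g t| => A B A0 B0.
have e : 2 ^+ n * (2 ^+ n)^-1 = 1 :> R by rewrite divff // gt_eqF.
have i0 : 0 < (2 ^+ n)^-1 :> R by rewrite invr_gt0.
have -> : 2 ^+ n * A ^+ 2 + (2 ^+ n)^-1 * B ^+ 2 =
  (2 ^+ n)^-1 * ((2 ^+ n * A - B) ^+ 2) + 2 * (2 ^+ n * (2 ^+ n)^-1) * (A * B).
  by field; rewrite gt_eqF.
rewrite e mulr1; have : 0 <= (2 ^+ n)^-1 * ((2 ^+ n * A - B) ^+ 2) by rewrite mulr_ge0 ?sqr_ge0 // ltW.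
by have := mulr_ge0 A0 B0; lra.
Qed.

(** The derivative of a state is part of the data and determined only up to a null set. Lebesgue
    differentiation of the vanishing primitive of [f - g] allows it to be exchanged for a classical
    derivative. *)
Lemma abs_cts_unique a b F f g : a <= b -> abs_cts a b F f -> abs_cts a b F g ->
  itv_int a b (fun x => (f x - g x) ^+ 2) = 0.
Proof.
move=> ab [hf hF] [hg hG].
pose d x := f x - g x.
have hd : itv_sq_integrable a b d by exact: itv_sq_integrableB.
have idd := itv_sq_integrableW hd.
have J0 x : x \in `[a, b]%R -> itv_int a x d = 0.
  move=> xab; have := xab; rewrite in_itv /= => /andP[ax xb].
  rewrite itv_intB; last 2 first.
  - exact: itv_integrableS (lexx a) xb (itv_sq_integrableW hf).
  - exact: itv_integrableS (lexx a) xb (itv_sq_integrableW hg).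
  by have := hF x xab; rewrite hG // => /addrI ->; rewrite subrr.
(* Extension by zero permits the base point [a - 1], so that every point of the interval, [a]
   included, lies strictly to its right. *)
pose e := d \_ `[a, b].
have locd : locally_integrable [set: R] e by apply: integrable_locally.
have ie y : leb.-integrable `[a - 1, y] (EFin \o e).
  have : leb.-integrable (`[a - 1, y] `&` `[a, b]) (EFin \o d).
    by apply: integrableS idd => //; exact: measurableI.
  by move/(@integrable_restrict _ _ _ leb _ (measurable_itv _) _ (measurable_itv _)); rewrite restrict_EFin.
have F0 : (fun x => \int[leb]_(t in [set` Interval (BLeft (a - 1)) (BRight x)]) e t) = fun=> 0.
  apply/funext => x; rewrite /e -Rintegral_mkcondr.
  have -> : [set` Interval (BLeft (a - 1)) (BRight x)] `&` `[a, b] = `[a, Num.min x b]%classic.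
    apply/seteqP; split => y /=; rewrite !in_itv /= le_min.
      by move=> [/andP[_ ->] /andP[-> ->]].
    move=> /andP[ay /andP[-> ->]]; rewrite ay; split => //; rewrite andbT; lra.
  have [xa|ax] := ltP x a; last by apply: J0; rewrite in_itv /= le_min ax ab ge_min lexx orbT.
  by rewrite set_itv_ge ?Rintegral_set0 // bnd_simp -ltNge gt_min xa.
have ae0 : ae_eq leb `[a, b]%classic (EFin \o (fun x => d x ^+ 2)) (EFin \o fun=> 0).
  have := FTC1 ie locd; apply: filterS; first exact: (ae_filter_ringOfSetsType leb).
  move=> x; rewrite F0 => h xab.
  have [|_] := h; first by move: xab; rewrite /= in_itv /= lte_fin => /andP[? _]; lra.
  by rewrite derive1_cst /e patchE mem_set // => dx /=; rewrite -dx expr0n.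
rewrite -[RHS](itv_int0 a b) /itv_int /Rintegral; congr fine.
apply: ae_eq_integral => //.
by apply/measurable_EFinP; apply: measurable_funX; exact: hd.1.
Qed.

End IntervalIntegral.

(** * The Riccati identity *)

Section States.
Variable R : realType.
Implicit Types (f g h u v du dv w : R -> R) (x y a b c d k t s mu lam th p : R).

Let pipi : - pi <= pi :> R.
Proof. by have := pi_gt0 R; lra. Qed.

Let p2 : 0 < 2 * pi :> R.
Proof. by have := pi_gt0 R; lra. Qed.

Local Notation integ := (@itv_integrable R (- pi) pi).
Local Notation sqint := (@itv_sq_integrable R (- pi) pi).

Lemma polar c d : exists r th, [/\ 0 <= r, c = r * cos th & d = r * sin th].
Proof.
pose r := Num.sqrt (c ^+ 2 + d ^+ 2).
have cd0 : 0 <= c ^+ 2 + d ^+ 2 by rewrite addr_ge0 ?sqr_ge0.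
have r2 : r ^+ 2 = c ^+ 2 + d ^+ 2 by rewrite sqr_sqrtr.
have r0 : 0 <= r by rewrite sqrtr_ge0.
have [re|rn] := eqVneq r 0.
  exists 0, 0; rewrite !mul0r; have /eqP := r2.
  rewrite re expr0n eq_sym paddr_eq0 ?sqr_ge0 // !sqrf_eq0 => /andP[/eqP -> /eqP ->].
  by split.
have rp : 0 < r by rewrite lt_def rn.
have cr : c / r \in `[(-1), 1]%R.
  have : `|c| <= r by rewrite -ler_sqr ?nnegrE // real_normK ?num_real // r2 lerDl sqr_ge0.
  by rewrite in_itv /= ler_norml ler_pdivlMr // ler_pdivrMr // mulN1r mul1r.
have sa : sin (acos (c / r)) = `|d| / r.
  rewrite sin_acos //; have -> : 1 - (c / r) ^+ 2 = (d / r) ^+ 2.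
    have d2 : d ^+ 2 = r ^+ 2 - c ^+ 2 by rewrite r2; ring.
    by rewrite !expr_div_n d2; field.
  by rewrite sqrtr_sqr normrM normfV (ger0_norm r0).
have ca := acosK cr.
exists r, (if 0 <= d then acos (c / r) else - acos (c / r)); split => //.
  by case: ifP => _; rewrite ?cosN ca mulrC divfK.
case: ifPn => [d0|]; first by rewrite sa ger0_norm // mulrC divfK.
by rewrite -ltNge => d0; rewrite sinN sa ltr0_norm // mulNr opprK mulrC divfK.
Qed.

Lemma avgE f : avg f = (2 * pi)^-1 * itv_int (- pi) pi f.
Proof. by []. Qed.

Lemma avg_ext f g : f =1 g -> avg f = avg g.
Proof. by move=> /funext ->. Qed.

Lemma avgD f g : integ f -> integ g -> avg (fun x => f x + g x) = avg f + avg g.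
Proof. by move=> hf hg; rewrite !avgE itv_intD // mulrDr. Qed.

Lemma avgB f g : integ f -> integ g -> avg (fun x => f x - g x) = avg f - avg g.
Proof. by move=> hf hg; rewrite !avgE itv_intB // mulrBr. Qed.

Lemma avgZ k f : integ f -> avg (fun x => k * f x) = k * avg f.
Proof. by move=> hf; rewrite !avgE itv_intZ // mulrCA. Qed.

Lemma avg_le f g : integ f -> integ g -> (forall x, f x <= g x) -> avg f <= avg g.
Proof.
move=> hf hg fg; rewrite !avgE ler_wpM2l ?invr_ge0 ?(ltW p2) //.
by apply: itv_int_le => // x _.
Qed.

Lemma avg_ge0 f : (forall x, 0 <= f x) -> 0 <= avg f.
Proof.
by move=> h; rewrite avgE mulr_ge0 ?invr_ge0 ?(ltW p2) //; apply: itv_int_ge0 => x _.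
Qed.

Lemma avg0 : avg (fun=> 0 : R) = 0.
Proof. by rewrite avgE itv_int0 mulr0. Qed.

Lemma avg_eq0 f : avg f = 0 -> itv_int (- pi) pi f = 0.
Proof. by rewrite avgE => /eqP; rewrite mulf_eq0 invr_eq0 gt_eqF //= => /eqP. Qed.

Lemma avg_der f f' : der f f' -> continuous f' -> f pi = f (- pi) -> avg f' = 0.
Proof.
by move=> df cf e; rewrite avgE (itv_int_FTC pipi df (within_cts cf)) e subrr mulr0.
Qed.

Lemma cts_integ f : continuous f -> integ f.
Proof. by move=> cf; exact/itv_integrable_cts/within_cts. Qed.

Lemma ctsM f g : continuous f -> continuous g -> continuous (fun x => f x * g x).
Proof. by move=> cf cg x; exact: (cvgM (cf x) (cg x)). Qed.

Lemma ctsD f g : continuous f -> continuous g -> continuous (fun x => f x + g x).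
Proof. by move=> cf cg x; exact: (cvgD (cf x) (cg x)). Qed.

Lemma cts_cst k : continuous (fun _ : R => k).
Proof. by move=> x; exact: cvg_cst. Qed.

Lemma H1per_abs_cts u du : H1per_deriv u du ->
  (forall x, u (x + 2 * pi) = u x) /\ abs_cts (- pi) pi u du.
Proof. by move=> [per [sq hu]]; split. Qed.

Lemma H1per_der u du : der u du -> continuous du -> (forall x, u (x + 2 * pi) = u x) ->
  H1per_deriv u du.
Proof.
move=> hu cdu per; have [sq h] := abs_cts_der (- pi) pi hu cdu.
by split => //; split.
Qed.

Definition state u v du dv := [/\ H1per_deriv u du, H1per_deriv v dv & unit_state u v].

(** This is the expectation of [cos (Q - th)], written as the projection of the vector of the two
    means on the direction [th]; the best direction gives the length of that vector. *)
Definition exp_dir th u v := cos th * exp_cos u v + sin th * exp_sin u v.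

(* The squared norm of [phi' - i p phi - w phi]. *)
Definition defect p w u v du dv :=
  avg (fun x => (du x + p * v x - w x * u x) ^+ 2 + (dv x - p * u x - w x * v x) ^+ 2).

Section OneState.
Variables u v du dv : R -> R.
Hypothesis st : state u v du dv.

Let hu : abs_cts (- pi) pi u du.
Proof. by case: st => /H1per_abs_cts[]. Qed.

Let hv : abs_cts (- pi) pi v dv.
Proof. by case: st => _ /H1per_abs_cts[]. Qed.

Let rho x := u x ^+ 2 + v x ^+ 2.

Let rho1 : avg rho = 1.
Proof. by case: st. Qed.

Let rho_ge0 x : 0 <= rho x.
Proof. by rewrite addr_ge0 ?sqr_ge0. Qed.

Let cu := abs_cts_within pipi hu.
Let cv := abs_cts_within pipi hv.

Lemma rho_abs_cts : abs_cts (- pi) pi rho (fun x => 2 * (u x * du x + v x * dv x)).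
Proof.
have [h1 e1] := abs_ctsM pipi hu hu; have [h2 e2] := abs_ctsM pipi hv hv.
have h3 := itv_sq_integrableD h1 h2.
have e x : du x * u x + u x * du x + (dv x * v x + v x * dv x) =
   2 * (u x * du x + v x * dv x) by ring.
split; first by move: h3; under eq_fun do rewrite e.
move=> x xpi; rewrite /rho !expr2 e1 // e2 //.
move: xpi; rewrite in_itv /= => /andP[xl xr].
have -> : itv_int (- pi) x (fun x => 2 * (u x * du x + v x * dv x)) =
  itv_int (- pi) x (fun x => du x * u x + u x * du x) +
  itv_int (- pi) x (fun x => dv x * v x + v x * dv x).
  rewrite -itv_intD.
  - by apply: itv_int_ext => t _; rewrite e.
  - by apply: itv_integrableS (itv_sq_integrableW h1) => //.
  - by apply: itv_integrableS (itv_sq_integrableW h2) => //.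
ring.
Qed.

Lemma rhoM_integ f : continuous f -> integ (fun x => f x * rho x).
Proof.
move=> cf; apply: itv_sq_integrableM; first exact/itv_sq_integrable_cts/within_cts.
exact/itv_sq_integrable_cts/(abs_cts_within pipi rho_abs_cts).
Qed.

Lemma rho_integ : integ rho.
Proof.
by apply: itv_integrable_ext (rhoM_integ (@cts_cst 1)) => x _; rewrite mul1r.
Qed.

Lemma avg_rhoM_cst k : avg (fun x => k * rho x) = k.
Proof. by rewrite avgZ ?rho1 ?mulr1 //; exact: rho_integ. Qed.

Lemma exp_dirE th : exp_dir th u v = avg (fun x => cos (x - th) * rho x).
Proof.
have c1 := rhoM_integ (@continuous_cos R); have c2 := rhoM_integ (@continuous_sin R).
rewrite /exp_dir -(avgZ _ c1) -(avgZ _ c2) -avgD; try exact: itv_integrableZ.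
by apply: avg_ext => x; rewrite cosB /rho; ring.
Qed.

Lemma exp_cos_le1 : exp_cos u v <= 1.
Proof.
rewrite -[X in _ <= X]rho1; apply: avg_le.
- exact: rhoM_integ (@continuous_cos R).
- exact: rho_integ.
- by move=> x; apply: ler_piMl; [exact: rho_ge0|exact: cos_le1].
Qed.

Lemma var_cossinE : var_cossin u v = 1 - exp_cos u v ^+ 2 - exp_sin u v ^+ 2.
Proof.
rewrite /var_cossin /var_cos /var_sin.
set c := exp_cos u v; set d := exp_sin u v.
have c1 := rhoM_integ (@continuous_cos R); have c2 := rhoM_integ (@continuous_sin R).
have i2 f k : continuous f -> integ (fun x => (f x - k) ^+ 2 * rho x).
  move=> cf; have cfk : continuous (fun x => f x - k).
    by apply: ctsD => //; exact: cts_cst.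
  exact: (rhoM_integ (ctsM cfk cfk)).
rewrite -avgD; [|exact: i2 (@continuous_cos R)|exact: i2 (@continuous_sin R)].
have -> : avg (fun x => (cos x - c) ^+ 2 * rho x + (sin x - d) ^+ 2 * rho x) =
  avg (fun x => (1 + c ^+ 2 + d ^+ 2) * rho x - (2 * c) * (cos x * rho x) - (2 * d) * (sin x * rho x)).
  by apply: avg_ext => x; rewrite -[X in (X + c ^+ 2 + _) * _](cos2Dsin2 x); ring.
have j0 := itv_integrableZ (1 + c ^+ 2 + d ^+ 2) rho_integ.
have j1 := itv_integrableZ (2 * c) c1; have j2 := itv_integrableZ (2 * d) c2.
rewrite (avgB (itv_integrableB j0 j1) j2) (avgB j0 j1) avg_rhoM_cst.
rewrite (avgZ _ c1) (avgZ _ c2) -/(exp_cos u v) -/(exp_sin u v) -/c -/d; ring.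
Qed.

Lemma exp_polar : exists th,
  0 <= exp_dir th u v /\ exp_dir th u v ^+ 2 = exp_cos u v ^+ 2 + exp_sin u v ^+ 2.
Proof.
have [r [th [r0 hc hs]]] := polar (exp_cos u v) (exp_sin u v).
have e : exp_dir th u v = r.
  rewrite /exp_dir hc hs.
  have -> : cos th * (r * cos th) + sin th * (r * sin th) = r * (cos th ^+ 2 + sin th ^+ 2) by ring.
  by rewrite cos2Dsin2 mulr1.
exists th; rewrite e; split => //.
by rewrite hc hs !exprMn -mulrDr cos2Dsin2 mulr1.
Qed.

Lemma exp_dir_le th : exp_dir th u v ^+ 2 <= exp_cos u v ^+ 2 + exp_sin u v ^+ 2.
Proof.
rewrite -subr_ge0 -[X in X - _]mul1r -(cos2Dsin2 th) /exp_dir.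
by set c := exp_cos _ _; set d := exp_sin _ _;
  have -> : (cos th ^+ 2 + sin th ^+ 2) * (c ^+ 2 + d ^+ 2) -
    (cos th * c + sin th * d) ^+ 2 = (sin th * c - cos th * d) ^+ 2 by [ring]; exact: sqr_ge0.
Qed.

(** Expanding the defect, the terms in [p] cancel against [w] and the cross term is [- w rho'],
    whose mean equals that of [w' rho]. No equation is imposed on [w], since approximate Riccati
    solutions are inserted as well. *)
Lemma riccati_identity w w' t th : der w w' -> continuous w' -> w pi = w (- pi) ->
  t * var_P u v du dv - exp_dir th u v = t * defect (exp_P u v du dv) w u v du dv +
    avg (fun x => - (t * (w' x + w x ^+ 2) + cos (x - th)) * rho x).
Proof.
move=> dw cw' wper.
rewrite /var_P /defect; set p := exp_P u v du dv.
have cw := der_continuous dw.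
have [su _] := hu; have [sv _] := hv.
have su0 := itv_sq_integrable_cts cu; have sv0 := itv_sq_integrable_cts cv.
have [sB eB] := abs_ctsM pipi (abs_cts_der (- pi) pi dw cw') rho_abs_cts.
(* [B] is the weak derivative of [w rho], a function with equal values at the two end points. *)
pose B x := w' x * rho x + w x * (2 * (u x * du x + v x * dv x)).
have B0 : avg B = 0.
  have rpi : rho pi = rho (- pi).
    have e : - pi + 2 * pi = pi :> R by ring.
    case: st => -[pu _] [pv _] _; have := pu (- pi); have := pv (- pi).
    by rewrite /rho e => -> ->.
  have /eB : pi \in `[(- pi : R), pi]%R by rewrite in_itv /= lexx pipi.
  rewrite wper rpi -/B => e; rewrite avgE.
  have -> : itv_int (- pi) pi B = 0.
    by apply: (addrI (w (- pi) * rho (- pi))); rewrite addr0 [RHS]e.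
  by rewrite mulr0.
have iB : integ B := itv_sq_integrableW sB.
have wsq f : sqint f -> sqint (fun x => w x * f x).
  by apply: itv_sq_integrableMc; exact: within_cts.
have sX : sqint (fun x => du x + p * v x - w x * u x).
  apply: itv_sq_integrableB; last exact: wsq.
  by apply: itv_sq_integrableD => //; exact: itv_sq_integrableZ.
have sY : sqint (fun x => dv x - p * u x - w x * v x).
  apply: itv_sq_integrableB; last exact: wsq.
  by apply: itv_sq_integrableB => //; exact: itv_sq_integrableZ.
have iA := itv_integrableD (itv_sq_integrable_sq sX) (itv_sq_integrable_sq sY).
have iw : integ (fun x => (w' x + w x ^+ 2) * rho x).
  by apply/rhoM_integ/ctsD => //; exact: (ctsM cw cw).
have ic : integ (fun x => cos (x - th) * rho x).
  apply: rhoM_integ.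
  exact: der_continuous (der_comp (@der_cos R) (derB (@der_id R) (der_cst th))).
have -> : avg (fun x => (dv x - p * u x) ^+ 2 + (du x + p * v x) ^+ 2) =
   avg (fun x => ((du x + p * v x - w x * u x) ^+ 2 + (dv x - p * u x - w x * v x) ^+ 2)
     - (w' x + w x ^+ 2) * rho x + B x).
  by apply: avg_ext => x; rewrite /B /rho; ring.
rewrite (avgD (itv_integrableB iA iw) iB) B0 addr0 (avgB iA iw) exp_dirE.
have -> : avg (fun x => - (t * (w' x + w x ^+ 2) + cos (x - th)) * rho x) =
  avg (fun x => (- t) * ((w' x + w x ^+ 2) * rho x) - cos (x - th) * rho x).
  by apply: avg_ext => x; ring.
rewrite (avgB (itv_integrableZ _ iw) ic) (avgZ _ iw); ring.
Qed.

Lemma defect_ge0 p w : 0 <= defect p w u v du dv.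
Proof. by apply: avg_ge0 => x; rewrite addr_ge0 ?sqr_ge0. Qed.

(** The defect is nonnegative and a pointwise bound integrates against the probability density, so
    an inexact [w] already certifies an energy bound. *)
Lemma riccati_lower w w' t th mu : der w w' -> continuous w' ->
  (forall x, w (x + 2 * pi) = w x) -> 0 <= t ->
  (forall x, mu <= - (t * (w' x + w x ^+ 2) + cos (x - th))) ->
  mu <= t * var_P u v du dv - exp_dir th u v.
Proof.
move=> dw cw' wper t0 hmu.
have wpi : w pi = w (- pi) by rewrite -(wper (- pi)); congr w; ring.
rewrite (riccati_identity t th dw cw' wpi) -[mu]add0r.
apply: lerD; first by rewrite mulr_ge0 ?defect_ge0.
rewrite -[X in X <= _](avg_rhoM_cst mu); apply: avg_le.
- exact: itv_integrableZ rho_integ.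
- have cw := der_continuous dw.
  have c2 : continuous (fun x => cos (x - th)).
    exact: der_continuous (der_comp (@der_cos R) (derB (@der_id R) (der_cst th))).
  have c3 := ctsM (@cts_cst t) (ctsD cw' (ctsM cw cw)).
  have := rhoM_integ (ctsM (@cts_cst (- 1)) (ctsD c3 c2)).
  by apply: itv_integrable_ext => x _; ring.
- by move=> x; rewrite ler_wpM2r.
Qed.

End OneState.
End States.

(** * Ground states and trial states *)

Section GroundEnergy.
Variable R : realType.
Implicit Types (f g h u v du dv w : R -> R) (x y a b c d k t s mu lam th p : R).

Let pipi : - pi <= pi :> R.
Proof. by have := pi_gt0 R; lra. Qed.

Let p2 : 0 < 2 * pi :> R.
Proof. by have := pi_gt0 R; lra. Qed.

Lemma cts_ext f g : continuous f -> f =1 g -> continuous g.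
Proof. by move=> cf /funext <-. Qed.

Lemma der_shift f f' th : der f f' -> der (fun x => f (x - th)) (fun x => f' (x - th)).
Proof.
move=> df; apply: der_eq (der_comp df (derB (@der_id R) (der_cst th))) _ => x.
by rewrite subr0 mulr1.
Qed.

Lemma periodic_shift f th : (forall x, f (x + 2 * pi) = f x) ->
  forall x, f (x + 2 * pi - th) = f (x - th).
Proof. by move=> per x; rewrite addrAC per. Qed.

Lemma periodic_bounded f : continuous f -> (forall x, f (x + 2 * pi) = f x) ->
  exists M, forall x, f x <= M.
Proof.
move=> cf per; have [c _ hc] := EVT_max pipi (within_cts cf).
exists (f c) => x; have [k h1 h2] := reduce_2pi x.
by rewrite -(periodic_int per k); apply: hc; rewrite in_itv /= h1 h2.
Qed.

Lemma primitive_periodic h : continuous h -> (forall x, h (x + 2 * pi) = h x) ->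
  itv_int (- pi) pi h = 0 -> exists2 G, der G h & forall x, G (x + 2 * pi) = G x.
Proof.
move=> ch per h0; have [G dG _] := der_continuous_primitive ch.
exists G => // x.
have ds : der (fun x => x + 2 * pi) (fun=> 1 : R).
  by apply: der_eq (derD (@der_id R) (der_cst _)) _ => y; rewrite addr0.
have dd : der (fun x => G (x + 2 * pi) - G x) (fun=> 0).
  by apply: der_eq (derB (der_comp dG ds) dG) _ => y; rewrite mulr1 per subrr.
have := itv_int_FTC pipi dG (within_cts ch); rewrite h0 => e.
have := der0_cst dd x (- pi).
have -> : - pi + 2 * pi = pi :> R by ring.
by rewrite -e => /eqP; rewrite subr_eq0 => /eqP.
Qed.

(** If the average were zero, the monotone primitive of [f^2] would be constant on the period, and
    its derivative at 0 is [f 0 ^ 2]. *)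
Lemma avg_sq_gt0 f f' : der f f' -> f 0 != 0 -> 0 < avg (fun x => f x ^+ 2).
Proof.
move=> df f0.
have cf := der_continuous df.
have ge : 0 <= avg (fun x => f x ^+ 2) by apply: avg_ge0 => x; exact: sqr_ge0.
rewrite lt_def ge andbT; apply/eqP => /avg_eq0 e.
have [P dP _] := der_continuous_primitive (ctsM cf cf).
have Pmono a b : a <= b -> P a <= P b.
  by apply: (der_ge0_ndecr dP) => x _; rewrite -expr2 sqr_ge0.
have Pe : P pi = P (- pi).
  have := itv_int_FTC pipi dP (within_cts (ctsM cf cf)).
  by rewrite [itv_int _ _ _]e => /esym/eqP; rewrite subr_eq0 => /eqP.
have Pc x : - pi <= x <= pi -> P x = P (- pi).
  by move=> /andP[/Pmono h1 /Pmono h2]; apply/eqP; rewrite eq_le h1 andbT -Pe.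
have d0 : is_derive (0 : R) (1 : R) (cst (P (- pi))) (f 0 * f 0).
  have pp := pi_gt0 R.
  apply: near_eq_is_derive (dP 0).
  near=> x; apply: Pc.
  apply/andP; split; apply: ltW; near: x.
    by apply: lt_nbhsr; rewrite oppr_lt0.
  exact: lt_nbhsl.
have := @derive_val _ _ _ _ _ _ _ d0; rewrite derive_cst => /esym/eqP.
by rewrite mulf_eq0 (negbTE f0).
Unshelve. all: by end_near. Qed.

Lemma normalized_state f f' : der f f' -> continuous f' ->
  (forall x, f (x + 2 * pi) = f x) -> f 0 != 0 ->
  exists2 k, k ^+ 2 * avg (fun x => f x ^+ 2) = 1 &
    state (fun x => k * f x) (fun=> 0) (fun x => k * f' x) (fun=> 0).
Proof.
move=> df cf' per f0.
have A0 := avg_sq_gt0 df f0; set A := avg _ in A0.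
pose k := (Num.sqrt A)^-1.
have k2 : k ^+ 2 * A = 1.
  by rewrite /k exprVn sqr_sqrtr ?(ltW A0) // mulVf // gt_eqF.
exists k => //; split.
- apply: H1per_der; first exact: derZ.
    exact: (ctsM (@cts_cst R k) cf').
  by move=> x; rewrite per.
- by apply: H1per_der => //; [exact: der_cst|exact: cts_cst].
- have cf := der_continuous df.
  rewrite /unit_state -[RHS]k2 -avgZ; last exact: cts_integ (ctsM cf cf).
  by apply: avg_ext => x; ring.
Qed.

Lemma exp_P_real u du : exp_P u (fun=> 0) du (fun=> 0) = 0.
Proof. by rewrite /exp_P -[RHS](avg0 R); apply: avg_ext => x; ring. Qed.

Lemma exp_dir0 u v : exp_dir 0 u v = exp_cos u v.
Proof. by rewrite /exp_dir cos0 sin0; ring. Qed.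

Section FixedGroundState.
Variables (s lam : R) (psi psi' : R -> R).
Hypotheses (s0 : 0 < s) (gs : ground_state s lam psi psi').

Definition log_der f f' x : R := f' x / f x.

Local Notation W := (log_der psi psi').

Let pp x : 0 < psi x. Proof. exact: gs.2. Qed.
Let pn x : psi x != 0. Proof. by rewrite gt_eqF. Qed.
Let sn : s != 0. Proof. by rewrite gt_eqF. Qed.
Let dpsi : der psi psi'. Proof. by case: gs => -[]. Qed.
Let per x : psi (x + 2 * pi) = psi x. Proof. by case: gs => -[_ ->]. Qed.
Let dpsi' : der psi' (fun x => - ((lam + cos x) / s) * psi x).
Proof. by case: gs => -[]. Qed.
Let per' x : psi' (x + 2 * pi) = psi' x. Proof. exact: der_periodic dpsi per x. Qed.
Let Wper x : W (x + 2 * pi) = W x.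
Proof. by rewrite /log_der per per'. Qed.

Lemma log_der_riccati : der W (fun x => - ((lam + cos x) / s) - W x ^+ 2).
Proof.
apply: der_eq (derM dpsi' (derV dpsi pn)) _ => x.
by rewrite /log_der; field; rewrite sn pn.
Qed.

Let cU : continuous (fun x => - ((lam + cos x) / s) : R).
Proof.
apply: der_continuous (der_ext (derZ (- s^-1) (derD (der_cst lam) (@der_cos R))) _) => x.
by rewrite mulNr mulrC.
Qed.

Let cW : continuous W. Proof. exact: der_continuous log_der_riccati. Qed.

Let cW' : continuous (fun x => - ((lam + cos x) / s) - W x ^+ 2).
Proof.
apply: cts_ext (ctsD cU (ctsM (@cts_cst R (- 1)) (ctsM cW cW))) _ => x; ring.
Qed.

Lemma cts_shift f th : continuous f -> continuous (fun x => f (x - th)).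
Proof.
move=> cf x; apply: (@continuous_comp _ _ _ (fun y => y - th) f); last exact: cf.
exact: (der_continuous (derB (@der_id R) (der_cst th))).
Qed.

Lemma ground_identity u v du dv th : state u v du dv ->
  s * var_P u v du dv - exp_dir th u v =
  lam + s * defect (exp_P u v du dv) (fun x => W (x - th)) u v du dv.
Proof.
move=> st.
have Wpi : W (pi - th) = W (- pi - th).
  by rewrite -(Wper (- pi - th)); congr W; ring.
rewrite (riccati_identity st s th (der_shift th log_der_riccati) (cts_shift cW') Wpi) addrC.
congr (_ + _); rewrite -[RHS](avg_rhoM_cst st lam); apply: avg_ext => x.
by congr (_ * _); field.
Qed.

Lemma ground_lower u v du dv th : state u v du dv ->
  lam <= s * var_P u v du dv - exp_dir th u v.
Proof.
move=> st; rewrite (ground_identity th st) lerDl mulr_ge0 ?(ltW s0) //.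
exact: defect_ge0.
Qed.

(* First order perturbation of the Riccati solution: [g' + 2 W g = - (psi''/psi + N)],
   solvable with periodic [g] by the choice of [N]. *)
Lemma ground_second_order : exists N K, forall t u v du dv th, 0 < t -> state u v du dv ->
  lam + (t - s) * N - (t - s) ^+ 2 / t * K <= t * var_P u v du dv - exp_dir th u v.
Proof.
pose U x := - ((lam + cos x) / s).
have Uper x : U (x + 2 * pi) = U x.
  by rewrite /U mulr_natl; have := @cosD2pi R x => ->.
have cpsi := der_continuous dpsi.
pose A := avg (fun x => psi x ^+ 2).
have A0 : 0 < A by apply: avg_sq_gt0 dpsi _.
pose B := avg (fun x => U x * (psi x * psi x)).
(* Solvability condition: it gives [h] mean zero. As [U = psi'' / psi], integration by parts
   identifies [N] with the momentum variance of the ground state. *)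
pose N := - B / A.
pose h x := - (U x + N) * (psi x * psi x).
have cpp := ctsM cpsi cpsi.
have cUpp := ctsM cU cpp.
have ch : continuous h.
  apply: cts_ext (ctsM (@cts_cst R (- 1)) (ctsM (ctsD cU (@cts_cst R N)) cpp)) _ => x; rewrite /h /U; ring.
have hper x : h (x + 2 * pi) = h x by rewrite /h Uper per.
have h0 : itv_int (- pi) pi h = 0.
  apply: avg_eq0.
  have -> : avg h = avg (fun x => - B / A * (- psi x ^+ 2) - U x * (psi x * psi x)).
    by apply: avg_ext => x; rewrite /h /N; ring.
  have i1 : itv_integrable (- pi) pi (fun x => - psi x ^+ 2).
    have := cts_integ (ctsM (@cts_cst R (- 1)) cpp).
    by apply: itv_integrable_ext => x _; ring.
  rewrite (avgB (itv_integrableZ _ i1) (cts_integ cUpp)) (avgZ _ i1) -/B.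
  have -> : avg (fun x => - psi x ^+ 2) = - A.
    rewrite -mulN1r -(avgZ _ (cts_integ cpp)).
    by apply: avg_ext => x; rewrite expr2; ring.
  by field; rewrite gt_eqF.
have [G dG Gper] := primitive_periodic ch hper h0.
(* [psi^2] is the integrating factor: [(psi^2 g)' = psi^2 (g' + 2 W g)]. *)
pose g x := G x / (psi x * psi x).
have dg : der g (fun x => - (U x + N) - 2 * W x * g x).
  apply: der_eq (derM dG (derV (derM dpsi dpsi) (fun x => mulf_neq0 (pn x) (pn x)))) _ => x.
  by rewrite /g /h /log_der; field; rewrite pn.
have gper x : g (x + 2 * pi) = g x by rewrite /g Gper per.
have cg := der_continuous dg.
have [K hK] : exists K, forall x, g x * g x <= K.
  by apply: periodic_bounded; [exact: ctsM|move=> x; rewrite gper].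
exists N, K => t u v du dv th t0 st.
have tn : t != 0 by rewrite gt_eqF.
(* With denominator [t] instead of [s] the terms in [U] recombine exactly to [s U], and the only
   error left is [- (t - s)^2 / t * g^2]. *)
pose e := (t - s) / t.
have dw := derD log_der_riccati (derZ e dg).
have cw : continuous (fun x => - ((lam + cos x) / s) - W x ^+ 2 + e * (- (U x + N) - 2 * W x * g x)).
  have c1 := ctsD cW' (ctsM (@cts_cst R (- e)) (ctsD cU (@cts_cst R N))).
  apply: cts_ext (ctsD c1 (ctsM (@cts_cst R (- e * 2)) (ctsM cW cg))) _ => x; rewrite /U; ring.
apply: (riccati_lower st (der_shift th dw) (cts_shift cw)).
- by move=> x; rewrite !periodic_shift.
- exact: ltW.
move=> x; set y := x - th.
have -> : - (t * (- ((lam + cos y) / s) - W y ^+ 2 + e * (- (U y + N) - 2 * W y * g y) +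
   (W y + e * g y) ^+ 2) + cos y) = lam + (t - s) * N - (t - s) ^+ 2 / t * (g y * g y).
  by rewrite /e /U; field; rewrite tn sn.
rewrite lerD2l lerN2 ler_wpM2l ?hK //.
by rewrite divr_ge0 ?sqr_ge0 // ltW.
Qed.

Lemma ground_attained : exists u v du dv,
  state u v du dv /\ s * var_P u v du dv - exp_dir 0 u v = lam.
Proof.
have [k _ st] := normalized_state dpsi (der_continuous dpsi') per (pn 0).
exists (fun x => k * psi x), (fun=> 0), (fun x => k * psi' x), (fun=> 0).
split=> //; rewrite (ground_identity 0 st) exp_P_real.
have -> : defect 0 (fun x => W (x - 0)) (fun x => k * psi x) (fun=> 0) (fun x => k * psi' x) (fun=> 0) = 0.
  rewrite /defect -[RHS](avg0 R); apply: avg_ext => x.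
  by rewrite subr0 /log_der; field.
by rewrite mulr0 addr0.
Qed.

(** Zero defect is a first-order linear system valid almost everywhere, solved by an integrating
    factor. Here [p] is any real number and the formula is confined to one period; periodicity of
    the state is exploited later. *)
Lemma defect_eq0 u v du dv th p : state u v du dv ->
  defect p (fun x => W (x - th)) u v du dv = 0 ->
  exists A B, forall x, x \in `[(- pi), pi]%R ->
    u x = psi (x - th) * (A * cos (p * x) - B * sin (p * x)) /\
    v x = psi (x - th) * (A * sin (p * x) + B * cos (p * x)).
Proof.
move=> st; have [/H1per_abs_cts[_ hu] /H1per_abs_cts[_ hv] _] := st.
pose w x := W (x - th); pose q x := psi (x - th).
have qn x : q x != 0 by exact: pn.
pose X x := du x + p * v x - w x * u x.
pose Y x := dv x - p * u x - w x * v x.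
have cu := abs_cts_within pipi hu; have cv := abs_cts_within pipi hv.
have su := itv_sq_integrable_cts cu; have sv := itv_sq_integrable_cts cv.
have cw : {within `[(- pi), pi], continuous w} by exact/within_cts/cts_shift.
have sX : itv_sq_integrable (- pi) pi X.
  apply: itv_sq_integrableB; last exact: itv_sq_integrableMc.
  by apply: itv_sq_integrableD; [exact: hu.1|exact: itv_sq_integrableZ].
have sY : itv_sq_integrable (- pi) pi Y.
  apply: itv_sq_integrableB; last exact: itv_sq_integrableMc.
  by apply: itv_sq_integrableB; [exact: hv.1|exact: itv_sq_integrableZ].
rewrite /defect => /avg_eq0.
rewrite (itv_intD (itv_sq_integrable_sq sX) (itv_sq_integrable_sq sY)) => d0.
have X0 : 0 <= itv_int (- pi) pi (fun x => X x ^+ 2) by apply: itv_int_ge0 => x _; exact: sqr_ge0.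
have Y0 : 0 <= itv_int (- pi) pi (fun x => Y x ^+ 2) by apply: itv_int_ge0 => x _; exact: sqr_ge0.
have {X0 Y0 d0} [X0 Y0] : itv_int (- pi) pi (fun x => X x ^+ 2) = 0 /\
    itv_int (- pi) pi (fun x => Y x ^+ 2) = 0 by split; lra.
have dpx : der (fun x => p * x) (fun=> p) by apply: der_eq (derZ p (@der_id R)) _ => x; rewrite mulr1.
have dq : der q (fun x => w x * q x).
  by apply: der_eq (der_shift th dpsi) _ => x; rewrite /w /log_der divfK.
pose al x := cos (p * x) / q x; pose be x := sin (p * x) / q x.
have dal : der al (fun x => - p * be x - w x * al x).
  apply: der_eq (derM (der_comp (@der_cos R) dpx) (derV dq qn)) _ => x.
  by rewrite /al /be; field; rewrite qn.
have dbe : der be (fun x => p * al x - w x * be x).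
  apply: der_eq (derM (der_comp (@der_sin R) dpx) (derV dq qn)) _ => x.
  by rewrite /al /be; field; rewrite qn.
have cal := der_continuous dal; have cbe := der_continuous dbe.
have cw' : continuous w by exact: cts_shift.
have aal : abs_cts (- pi) pi al (fun x => - p * be x - w x * al x).
  apply: abs_cts_der => //.
  apply: cts_ext (ctsD (ctsM (@cts_cst R (- p)) cbe) (ctsM (@cts_cst R (- 1)) (ctsM cw' cal))) _ => x; ring.
have abe : abs_cts (- pi) pi be (fun x => p * al x - w x * be x).
  apply: abs_cts_der => //.
  apply: cts_ext (ctsD (ctsM (@cts_cst R p) cal) (ctsM (@cts_cst R (- 1)) (ctsM cw' cbe))) _ => x; ring.
have sal : itv_sq_integrable (- pi) pi al by exact/itv_sq_integrable_cts/within_cts.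
have sbe : itv_sq_integrable (- pi) pi be by exact/itv_sq_integrable_cts/within_cts.
(* [f + i g = (u + i v) exp(- i p x) / q] has vanishing derivative. *)
pose f x := u x * al x + v x * be x; pose g x := v x * al x - u x * be x.
have sub F x : x \in `[(- pi : R), pi]%R -> itv_integrable (- pi) pi F -> itv_integrable (- pi) x F.
  by rewrite in_itv /= => /andP[_ xr]; exact: itv_integrableS.
have [i1 h1] := abs_ctsM pipi hu aal; have [i2 h2] := abs_ctsM pipi hv abe.
have [i3 h3] := abs_ctsM pipi hv aal; have [i4 h4] := abs_ctsM pipi hu abe.
have fc x : x \in `[(- pi : R), pi]%R -> f x = f (- pi).
  move=> xpi; rewrite /f h1 // h2 //.
  have e : itv_int (- pi) x (fun x => du x * al x + u x * (- p * be x - w x * al x)) +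
      itv_int (- pi) x (fun x => dv x * be x + v x * (p * al x - w x * be x)) =
      itv_int (- pi) x (fun x => X x * al x) + itv_int (- pi) x (fun x => Y x * be x).
    rewrite -!itv_intD.
    - by apply: itv_int_ext => t _; rewrite /X /Y; ring.
    - by apply: sub => //; exact: itv_sq_integrableM.
    - by apply: sub => //; exact: itv_sq_integrableM.
    - by apply: sub => //; exact: itv_sq_integrableW.
    - by apply: sub => //; exact: itv_sq_integrableW.
  have := itv_int_sq0 sX sal X0 xpi; have := itv_int_sq0 sY sbe Y0 xpi.
  by move=> e1 e2; rewrite e1 e2 in e; lra.
have gc x : x \in `[(- pi : R), pi]%R -> g x = g (- pi).
  move=> xpi; rewrite /g h3 // h4 //.
  have e : itv_int (- pi) x (fun x => dv x * al x + v x * (- p * be x - w x * al x)) -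
      itv_int (- pi) x (fun x => du x * be x + u x * (p * al x - w x * be x)) =
      itv_int (- pi) x (fun x => Y x * al x) - itv_int (- pi) x (fun x => X x * be x).
    rewrite -!itv_intB.
    - by apply: itv_int_ext => t _; rewrite /X /Y; ring.
    - by apply: sub => //; exact: itv_sq_integrableM.
    - by apply: sub => //; exact: itv_sq_integrableM.
    - by apply: sub => //; exact: itv_sq_integrableW.
    - by apply: sub => //; exact: itv_sq_integrableW.
  have := itv_int_sq0 sX sbe X0 xpi; have := itv_int_sq0 sY sal Y0 xpi.
  by move=> e1 e2; rewrite e1 e2 in e; lra.
exists (f (- pi)), (g (- pi)) => x xpi; rewrite -(fc x xpi) -(gc x xpi) -/(q x).
have cs := cos2Dsin2 (p * x).
have e1 : u x = u x * (cos (p * x) ^+ 2 + sin (p * x) ^+ 2) by rewrite cs mulr1.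
have e2 : v x = v x * (cos (p * x) ^+ 2 + sin (p * x) ^+ 2) by rewrite cs mulr1.
split; [rewrite [LHS]e1|rewrite [LHS]e2]; rewrite /f /g /al /be; field; exact: qn.
Qed.

End FixedGroundState.

(** * Trial states concentrated at the origin *)

Lemma derX f f' n : der f f' -> der (fun x => f x ^+ n.+1) (fun x => n.+1%:R * f x ^+ n * f' x).
Proof.
move=> df; elim: n => [|n IH].
  by apply: der_eq df _ => x; rewrite expr0 !mul1r.
apply: der_ext (_ : der (fun x => f x * f x ^+ n.+1) _) _; last by move=> x; rewrite -exprS.
by apply: der_eq (derM df IH) _ => x; rewrite -[n.+2%:R]natr1 exprS; ring.
Qed.

(** The integrand is the derivative of [sin x (1 + cos x)^(n+1)], because
    [sin^2 = (1 - cos) (1 + cos)]. It yields the mean of the cosine under the weight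
    [(1 + cos x)^(n+1)] without evaluating any integral. *)
Lemma cos_pow_avg n : avg (fun x : R => (n.+2%:R * cos x - n.+1%:R) * (1 + cos x) ^+ n.+1) = 0.
Proof.
have dc : der (fun x : R => 1 + cos x) (fun x => - sin x).
  by apply: der_eq (derD (der_cst 1) (@der_cos R)) _ => x; rewrite add0r.
have d := derM (@der_sin R) (derX n dc).
have {}d : der (fun x => sin x * (1 + cos x) ^+ n.+1)
   (fun x => (n.+2%:R * cos x - n.+1%:R) * (1 + cos x) ^+ n.+1).
  apply: der_eq d _ => x.
  rewrite -[n.+2%:R]natr1 exprS.
  have -> : sin x * (n.+1%:R * (1 + cos x) ^+ n * - sin x) =
     - n.+1%:R * (1 + cos x) ^+ n * sin x ^+ 2 by ring.
  by rewrite sin2cos2; ring.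
apply: avg_der d _ _; last by rewrite sinN sinpi oppr0 !mul0r.
have c1 : continuous (fun x : R => (1 + cos x) ^+ n.+1) := der_continuous (derX n dc).
have c2 := ctsD (ctsM (@cts_cst R n.+2%:R) (@continuous_cos R)) (@cts_cst R (- n.+1%:R)).
exact: (ctsM c2 c1).
Qed.

(** For [phi] proportional to [(1 + cos x)^(n+1)] the density has exponent [m + 1 = 2 n + 2], so the
    mean of the cosine is exactly [1 - 1 / (m + 2)]. Such states control the dual function near
    [s = 0]. *)
Lemma concentrated_state e : 0 < e -> exists u v du dv,
  state u v du dv /\ 1 - e < exp_cos u v.
Proof.
move=> e0.
have dc : der (fun x : R => 1 + cos x) (fun x => - sin x).
  by apply: der_eq (derD (der_cst 1) (@der_cos R)) _ => x; rewrite add0r.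
pose n := Num.bound e^-1.
have n0 : e^-1 < n%:R by apply: archi_boundP; rewrite invr_ge0 ltW.
have df := derX n dc; set f := fun x : R => (1 + cos x) ^+ n.+1 in df.
have cf' : continuous (fun x : R => n.+1%:R * (1 + cos x) ^+ n * - sin x).
  have cc : continuous (fun x : R => (1 + cos x) ^+ n).
    case: (n) => [|m]; first exact: cts_cst.
    exact: der_continuous (derX m dc).
  apply: cts_ext (ctsM (@cts_cst R (- n.+1%:R)) (ctsM cc (@continuous_sin R))) _ => x; ring.
have per x : f (x + 2 * pi) = f x.
  by rewrite /f mulr_natl; have := @cosD2pi R x => ->.
have f0 : f 0 != 0 by rewrite /f cos0 expf_neq0.
have [k k2 st] := normalized_state df cf' per f0.
exists (fun x => k * f x), (fun=> 0), (fun x => k * (n.+1%:R * (1 + cos x) ^+ n * - sin x)), (fun=> 0).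
split=> //; set u := fun x => k * f x in st *.
pose m := (n.*2.+1)%N.
have cf := der_continuous df.
have iff := cts_integ (ctsM cf cf).
have icff := cts_integ (ctsM (@continuous_cos R) (ctsM cf cf)).
have ecE : exp_cos u (fun=> 0) = k ^+ 2 * avg (fun x => cos x * (f x * f x)).
  by rewrite -(avgZ _ icff); apply: avg_ext => x; rewrite /u; ring.
have key : m.+2%:R * avg (fun x => cos x * (f x * f x)) - m.+1%:R * avg (fun x => f x ^+ 2) = 0.
  rewrite -(avgZ _ icff) -(avgZ m.+1%:R iff).
  rewrite -(avgB (itv_integrableZ _ icff) (itv_integrableZ _ iff)) -[RHS](cos_pow_avg m).
  apply: avg_ext => x; rewrite /f.
  have -> : (1 + cos x) ^+ m.+1 = (1 + cos x) ^+ n.+1 * (1 + cos x) ^+ n.+1.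
    by rewrite -exprD; congr (_ ^+ _); rewrite /m addSn addnS addnn.
  ring.
have ec : m.+2%:R * exp_cos u (fun=> 0) = m.+1%:R.
  rewrite ecE mulrCA; move/eqP: key; rewrite subr_eq0 => /eqP ->.
  by rewrite mulrCA k2 mulr1.
have m2 : 0 < m.+2%:R :> R by rewrite ltr0n.
rewrite -(ltr_pM2l m2) ec.
have -> : m.+1%:R = m.+2%:R - 1 :> R by rewrite -[m.+2%:R]natr1 addrK.
rewrite mulrBr mulr1 ltrD2l ltrN2.
have nm : n%:R <= m.+2%:R :> R by rewrite ler_nat /m -addnn; do 2 apply: leqW; rewrite -addSn leq_addl.
rewrite -ltr_pdivrMr // div1r.
exact: lt_le_trans n0 nm.
Qed.

End GroundEnergy.

(** * The minimization problem *)

Section Minimization.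
Variable R : realType.
Implicit Types (u v du dv : R -> R) (x y a b c d k t s mu lam th p : R).

Let pipi : - pi <= pi :> R.
Proof. by have := pi_gt0 R; lra. Qed.

Lemma var_P_ge0 u v du dv : 0 <= var_P u v du dv.
Proof. by apply: avg_ge0 => x; rewrite addr_ge0 ?sqr_ge0. Qed.

Definition ground_energy s : R := s * a0 (2 / s) / 4.

Local Notation L := ground_energy.

Lemma ground_energyE s lam psi psi' : 0 < s -> ground_state s lam psi psi' -> L s = lam.
Proof.
move=> s0 gs; rewrite /ground_energy -a0N (ground_state_a0 s0 gs).
by field; rewrite gt_eqF.
Qed.

Lemma ground_energy_exists s : 0 < s -> exists psi psi', ground_state s (L s) psi psi'.
Proof.
move=> s0; have [lam [psi [psi' gs]]] := ground_state_exists s0.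
by exists psi, psi'; rewrite (ground_energyE s0 gs).
Qed.

Lemma ground_energy_lower s u v du dv th : 0 < s -> state u v du dv ->
  L s <= s * var_P u v du dv - exp_dir th u v.
Proof. by move=> s0; have [psi [psi' gs]] := ground_energy_exists s0; exact: (ground_lower s0 gs). Qed.

Lemma ground_energy_attained s : 0 < s -> exists u v du dv,
  state u v du dv /\ s * var_P u v du dv - exp_dir 0 u v = L s.
Proof. by move=> s0; have [psi [psi' gs]] := ground_energy_exists s0; exact: (ground_attained s0 gs). Qed.

(** Tested on the constant state, which has zero momentum variance; a direction from [exp_polar]
    saves computing its mean cosine. *)
Lemma ground_energy_le0 s : 0 < s -> L s <= 0.
Proof.
move=> s0.
have [|k _ st] := normalized_state (der_cst 1) (@cts_cst R 0) (fun x => erefl) _.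
  exact: oner_neq0.
have [th [pos _]] := exp_polar (fun x => k * 1) (fun=> 0).
have := ground_energy_lower th s0 st.
have -> : var_P (fun x => k * 1) (fun=> 0) (fun x => k * 0) (fun=> 0) = 0.
  rewrite /var_P exp_P_real -[RHS](avg0 R); apply: avg_ext => x; ring.
by rewrite mulr0; lra.
Qed.

(** [L] lies below the affine function of [t] given by the ground state at [a]. Its slope is at most
    [1 / e], as [a] times the momentum variance equals [L a] plus a mean cosine, hence is at most
    1. *)
Lemma ground_energy_lipschitz e s t : 0 < e -> e <= s -> e <= t -> `|L t - L s| <= e^-1 * `|t - s|.
Proof.
move=> e0.
suff half a b : e <= a -> e <= b -> L b - L a <= e^-1 * `|b - a|.
  move=> es et; rewrite ler_norml; apply/andP; split; last exact: half.
  by have := half _ _ et es; rewrite distrC; lra.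
move=> ea eb; have a0 : 0 < a by lra.
have b0 : 0 < b by lra.
have [u [v [du [dv [st h]]]]] := ground_energy_attained a0.
have := ground_energy_lower 0 b0 st; have := ground_energy_le0 a0.
rewrite -h exp_dir0; have := exp_cos_le1 st; have := var_P_ge0 u v du dv.
set n := var_P _ _ _ _; set c := exp_cos _ _ => n0 c1 l0 hb.
have n1 : n <= e^-1.
  rewrite -[e^-1]mul1r ler_pdivlMr //.
  have : n * e <= n * a by rewrite ler_wpM2l.
  lra.
have := ler_norm (b - a); have := normr_ge0 (b - a) => h1 h2.
have : (b - a) * n <= `|b - a| * n by rewrite ler_wpM2r.
have : n * `|b - a| <= e^-1 * `|b - a| by rewrite ler_wpM2r.
lra.
Qed.

(** A linear term cannot be held above a negative quadratic one on both sides of [s] unless it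
    vanishes. This takes the place of differentiating [L]. *)
Lemma second_order_slope s c K : 0 < s ->
  (forall t, 0 < t -> - ((t - s) ^+ 2 / t * K) <= (t - s) * c) -> c = 0.
Proof.
move=> s0 h.
pose M := `|K| + 1.
have M0 : 0 < M by rewrite /M ltr_wpDl.
have KM : K <= M by rewrite /M; have := ler_norm K; lra.
have {}h t : 0 < t -> - ((t - s) ^+ 2 / t * M) <= (t - s) * c.
  move=> t0; apply: le_trans (h t t0); rewrite lerN2 ler_wpM2l //.
  by rewrite divr_ge0 ?sqr_ge0 // ltW.
have [c0|c0|//] := ltgtP c 0.
  pose d := - c * s / (2 * M).
  have d0 : 0 < d by rewrite /d divr_gt0 ?mulr_gt0 //; lra.
  have t0 : 0 < s + d by lra.
  have := h _ t0.
  have -> : s + d - s = d by ring.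
  have : d ^+ 2 / (s + d) * M <= d ^+ 2 / s * M.
    rewrite ler_pM2r // ler_pM2l ?exprn_gt0 // lef_pV2 ?posrE //; lra.
  have -> : d ^+ 2 / s * M = d * (- c / 2).
    by rewrite /d; field; rewrite !gt_eqF.
  have : 0 < d * (- c) by rewrite mulr_gt0 // oppr_gt0.
  by move=> h1 h2 h3; lra.
(* To the left of [s] the factor [1 / t] grows; [d <= s / 2] keeps it below [2 / s], and the other
   bound makes the quadratic term at most [d c / 2]. *)
pose d := Num.min (s / 2) (c * s / (4 * M)).
have d0 : 0 < d by rewrite /d lt_min !divr_gt0 ?mulr_gt0.
have d1 : d <= s / 2 by rewrite /d ge_min lexx.
have d2 : d <= c * s / (4 * M) by rewrite /d ge_min lexx orbT.
have t0 : 0 < s - d by lra.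
have := h _ t0.
have -> : s - d - s = - d by ring.
rewrite sqrrN.
have : d ^+ 2 / (s - d) * M <= d ^+ 2 / (s / 2) * M.
  rewrite ler_pM2r // ler_pM2l ?exprn_gt0 // lef_pV2 ?posrE //; lra.
have : d * (d * (2 * M / s)) <= d * (c * s / (4 * M) * (2 * M / s)).
  by rewrite ler_pM2l // ler_pM2r // !mulr_gt0 ?invr_gt0.
have -> : c * s / (4 * M) * (2 * M / s) = c / 2 by field; rewrite !gt_eqF.
have -> : d ^+ 2 / (s / 2) * M = d * (d * (2 * M / s)) by field; rewrite gt_eqF.
have : 0 < d * c by rewrite mulr_gt0.
by move=> h1 h2 h3 h4; lra.
Qed.

Lemma sin_int_pi (k : int) : sin (k%:~R * pi) = 0 :> R.
Proof.
have hn (n : nat) : sin (n%:R * pi) = 0 :> R.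
  elim: n => [|n IH]; first by rewrite mul0r sin0.
  by rewrite -natr1 mulrDl mul1r sinDpi IH oppr0.
by case: k => n; rewrite ?NegzE ?mulrNz ?mulNr ?sinN -pmulrn hn ?oppr0.
Qed.

Lemma sin_pi_eq0 p : sin (p * pi) = 0 -> exists k : int, p = k%:~R.
Proof.
move=> h; exists (Num.floor p); apply/eqP; rewrite -subr_eq0; apply/eqP.
set r := p - _.
have r0 : 0 <= r by rewrite subr_ge0 Num.Theory.ge_floor.
have r1 : r < 1.
  by have := Num.Theory.floorD1_gt p; rewrite intrD /r => ?; lra.
have sr : sin (r * pi) = 0 by rewrite /r mulrBl sinB h sin_int_pi; ring.
apply/eqP; rewrite eq_le r0 andbT leNgt; apply/negP => rp.
have : 0 < sin (r * pi).
  apply: sin_gt0_pi; rewrite mulr_gt0 ?pi_gt0 //=.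
  by rewrite -[X in _ < X]mul1r ltr_pM2r ?pi_gt0.
by rewrite sr ltxx.
Qed.

(** The given [du], [dv] need not be the classical derivatives, so the differences [X], [Y] are
    carried along; they are null in mean square, whence the mean momentum is [p] and the defect
    vanishes. *)
Lemma phase_state_defect s lam psi psi' u v du dv c p alpha th : 0 < s ->
  ground_state s lam psi psi' -> state u v du dv ->
  (forall x, u x = c * cos (p * x + alpha) * psi (x - th)) ->
  (forall x, v x = c * sin (p * x + alpha) * psi (x - th)) ->
  defect (exp_P u v du dv) (fun x => log_der psi psi' (x - th)) u v du dv = 0.
Proof.
move=> s0 gs st hu hv.
have [[_ _ dpsi _] pp] := gs.
have pn x : psi x != 0 by rewrite gt_eqF.
pose w x := log_der psi psi' (x - th).
have cw : continuous w := cts_shift (der_continuous (log_der_riccati s0 gs)).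
have dq : der (fun x => psi (x - th)) (fun x => w x * psi (x - th)).
  by apply: der_eq (der_shift th dpsi) _ => x; rewrite /w /log_der divfK.
have dph := der_affine p alpha.
have du' : der u (fun x => w x * u x - p * v x).
  apply: der_ext (der_eq (derM (derZ c (der_comp (@der_cos R) dph)) dq) _) _.
    by move=> x /=; rewrite hu hv; ring.
  by move=> x; rewrite hu.
have dv' : der v (fun x => w x * v x + p * u x).
  apply: der_ext (der_eq (derM (derZ c (der_comp (@der_sin R) dph)) dq) _) _.
    by move=> x /=; rewrite hu hv; ring.
  by move=> x; rewrite hv.
have cu := der_continuous du'; have cv := der_continuous dv'.
have cdu : continuous (fun x => w x * u x - p * v x).
  by apply: cts_ext (ctsD (ctsM cw cu) (ctsM (@cts_cst R (- p)) cv)) _ => x; ring.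
have cdv : continuous (fun x => w x * v x + p * u x).
  exact: (ctsD (ctsM cw cv) (ctsM (@cts_cst R p) cu)).
have [/H1per_abs_cts[_ au] /H1per_abs_cts[_ av] _] := st.
have au' := abs_cts_der (- pi) pi du' cdu; have av' := abs_cts_der (- pi) pi dv' cdv.
have u0 := abs_cts_unique pipi au au'; have v0 := abs_cts_unique pipi av av'.
pose X x := du x - (w x * u x - p * v x); pose Y x := dv x - (w x * v x + p * u x).
have sX : itv_sq_integrable (- pi) pi X by exact: itv_sq_integrableB au.1 au'.1.
have sY : itv_sq_integrable (- pi) pi Y by exact: itv_sq_integrableB av.1 av'.1.
have su : itv_sq_integrable (- pi) pi u by exact/itv_sq_integrable_cts/within_cts.
have sv : itv_sq_integrable (- pi) pi v by exact/itv_sq_integrable_cts/within_cts.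
have pin : pi \in `[(- pi : R), pi]%R by rewrite in_itv /= lexx pipi.
have pE : exp_P u v du dv = p.
  have -> : exp_P u v du dv =
      avg (fun x => p * (u x ^+ 2 + v x ^+ 2) + (Y x * u x - X x * v x)).
    by apply: avg_ext => x; rewrite /X /Y; ring.
  have i1 := itv_integrableZ p (rho_integ st).
  have i2 := itv_sq_integrableM sY su; have i3 := itv_sq_integrableM sX sv.
  rewrite (avgD i1 (itv_integrableB i2 i3)) (avgB i2 i3) (avg_rhoM_cst st).
  by rewrite !avgE (itv_int_sq0 sY su v0 pin) (itv_int_sq0 sX sv u0 pin) mulr0 subrr addr0.
rewrite pE /defect.
have -> : avg (fun x => (du x + p * v x - w x * u x) ^+ 2 + (dv x - p * u x - w x * v x) ^+ 2) =
    avg (fun x => X x ^+ 2 + Y x ^+ 2) by apply: avg_ext => x; rewrite /X /Y; ring.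
rewrite (avgD (itv_sq_integrable_sq sX) (itv_sq_integrable_sq sY)) !avgE.
by rewrite [X in _ * X + _]u0 [X in _ + _ * X]v0 mulr0 addr0.
Qed.

Lemma zero_defect_phase_state s lam psi psi' u v du dv p th : 0 < s ->
  ground_state s lam psi psi' -> state u v du dv ->
  defect p (fun x => log_der psi psi' (x - th)) u v du dv = 0 ->
  exists r alpha (k : int), forall x,
    u x = r * cos (k%:~R * x + alpha) * psi (x - th) /\
    v x = r * sin (k%:~R * x + alpha) * psi (x - th).
Proof.
move=> s0 gs st d0.
have [A [B hAB]] := defect_eq0 s0 gs st d0.
have [[_ per _ _] pp] := gs.
have [[pu _] [pv _] st1] := st.
have pin : pi \in `[(- pi : R), pi]%R by rewrite in_itv /= lexx pipi.
have nin : - pi \in `[(- pi : R), pi]%R by rewrite in_itv /= lexx pipi.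
have pE : - pi + 2 * pi = pi :> R by ring.
have [up vp] := hAB _ pin; have [un vn] := hAB _ nin.
have := pu (- pi); have := pv (- pi); rewrite pE up vp un vn.
have -> : psi (pi - th) = psi (- pi - th) by rewrite -(per (- pi - th)); congr psi; ring.
rewrite !mulrN cosN sinN => /(mulfI (lt0r_neq0 (pp _))) e1 /(mulfI (lt0r_neq0 (pp _))) e2.
(* Equal values at [- pi] and [pi] kill the part of the phase that is odd in x. As [A = B = 0]
   contradicts normalization, [sin (p pi) = 0]. *)
have Asin : A * sin (p * pi) = 0 by lra.
have Bsin : B * sin (p * pi) = 0 by lra.
have sp : sin (p * pi) = 0.
  apply/eqP; apply/negPn/negP => sn.
  have A0 : A = 0 by move/eqP: Asin; rewrite mulf_eq0 (negbTE sn) orbF => /eqP.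
  have B0 : B = 0 by move/eqP: Bsin; rewrite mulf_eq0 (negbTE sn) orbF => /eqP.
  have : avg (fun x => u x ^+ 2 + v x ^+ 2) = avg (fun=> 0).
    rewrite !avgE; congr (_ * _); apply: itv_int_ext => x /hAB[-> ->].
    by rewrite A0 B0; ring.
  by rewrite avg0 [LHS]st1 => /eqP; rewrite oner_eq0.
have [k pk] := sin_pi_eq0 sp.
have [r [alpha [_ rA rB]]] := polar A B.
exists r, alpha, k.
have main x : x \in `[(- pi : R), pi]%R ->
    u x = r * cos (k%:~R * x + alpha) * psi (x - th) /\
    v x = r * sin (k%:~R * x + alpha) * psi (x - th).
  by move=> /hAB[-> ->]; rewrite pk rA rB cosD sinD; split; ring.
move=> x; have [j h1 h2] := reduce_2pi x.
have xin : x + j%:~R * (2 * pi) \in `[(- pi : R), pi]%R by rewrite in_itv /= h1 h2.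
have [] := main _ xin.
rewrite (periodic_int pu) (periodic_int pv) addrAC (periodic_int per).
have -> : k%:~R * (x + j%:~R * (2 * pi)) + alpha = k%:~R * x + alpha + (k * j)%:~R * (2 * pi) :> R.
  by rewrite intrM; ring.
have cper y : cos (y + 2 * pi) = cos y :> R by rewrite mulr_natl; exact: cosD2pi.
have sper y : sin (y + 2 * pi) = sin y :> R by rewrite mulr_natl; exact: sinD2pi.
by rewrite (periodic_int cper) (periodic_int sper).
Qed.

(** * Duality for a fixed bound on the momentum variance *)

Section Bound.
Variable E : R.
Hypothesis E0 : 0 < E.

Let F s := s * E - L s.

(** [F] falls below 1 at some point and is at least as large as there, both near 0 and for large
    [s]; the minimum over the remaining compact interval is global. *)
Lemma dual_min_exists : exists2 s1, 0 < s1 & forall s, 0 < s -> F s1 <= F s.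
Proof.
pose c := E + 1.
(* Trial [w = - c sin x], the logarithmic derivative of [exp (c cos x)]. This [s1] cancels the term
   linear in [1 - cos x], so [L s1 >= - (1 - s1 c)]; the choice [c = E + 1] then gives
   [F s1 <= 1 - s1]. *)
pose s1 := (c + 2 * c ^+ 2)^-1.
have c0 : 0 < c by rewrite /c ltr_pwDl // ltW.
have q0 : 0 < c + 2 * c ^+ 2 by rewrite addr_gt0 // mulr_gt0 // exprn_gt0.
have s10 : 0 < s1 by rewrite invr_gt0.
have s1E : s1 * c + 2 * (s1 * c ^+ 2) = 1.
  by rewrite /s1; field; rewrite gt_eqF.
have F1 : F s1 < 1.
  suff : - (1 - s1 * c) <= L s1.
    rewrite /F; have -> : s1 * c = s1 * E + s1 by rewrite /c; ring.
    by lra.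
  have [u [v [du [dv [st h]]]]] := ground_energy_attained s10.
  have dw : der (fun x => - c * sin x) (fun x => - c * cos x) by exact: derZ (@der_sin R).
  rewrite -h; apply: (riccati_lower st dw).
  - exact: (ctsM (@cts_cst R (- c)) (@continuous_cos R)).
  - by move=> x; rewrite mulr_natl; have := @sinD2pi R x => ->.
  - exact: ltW.
  move=> x; rewrite subr0 lerN2 exprMn sin2cos2.
  have x1 := cos_le1 x; have x2 := cos_geN1 x.
  have y0 : 0 <= s1 * c ^+ 2 by rewrite mulr_ge0 ?sqr_ge0 // ltW.
  move: s1E y0; rewrite sqrrN; set al := s1 * c ^+ 2; set be := s1 * c => s1E y0.
  have -> : s1 * (- c * cos x + c ^+ 2 * (1 - cos x ^+ 2)) + cos x =
    (1 - be) - (1 - cos x) * (1 - be - 2 * al) - (1 - cos x) ^+ 2 * al by rewrite /al /be; ring.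
  have -> : 1 - be - 2 * al = 0 by lra.
  rewrite mulr0 subr0; have : 0 <= (1 - cos x) ^+ 2 * al by rewrite mulr_ge0 ?sqr_ge0.
  by lra.
have e0 : 0 < (1 - F s1) / 2 by lra.
have [u [v [du [dv [st hc]]]]] := concentrated_state e0.
pose n := var_P u v du dv; have n0 : 0 <= n := var_P_ge0 u v du dv.
pose sl := Num.min s1 ((1 - F s1) / 2 / (n + 1)).
have sl0 : 0 < sl by rewrite /sl lt_min s10 divr_gt0 //; lra.
have sl1 : sl <= s1 by rewrite /sl ge_min lexx.
(* Half of the gap [1 - F s1] is spent on the mean cosine of the concentrated state, the other half
   on [s] times its momentum variance. *)
have small s : 0 < s -> s <= sl -> F s1 <= F s.
  move=> s0 ssl.
  have := ground_energy_lower 0 s0 st; rewrite exp_dir0 -/n /F => hL.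
  have sn : s * n <= (1 - F s1) / 2.
    have : s * (n + 1) <= (1 - F s1) / 2.
      rewrite -ler_pdivlMr; last by lra.
      by apply: le_trans ssl _; rewrite /sl ge_min lexx orbT.
    by have := s0; lra.
  have : 0 < s * E by rewrite mulr_gt0.
  by move: sn hc; rewrite /F; lra.
pose sr := Num.max s1 E^-1.
have sr1 : s1 <= sr by rewrite /sr le_max lexx.
have large s : sr <= s -> F s1 <= F s.
  rewrite /sr ge_max => /andP[h1 h2].
  have s0 : 0 < s by lra.
  have : 1 <= s * E by rewrite -ler_pdivrMr // div1r.
  by have := ground_energy_le0 s0; move: F1; rewrite /F; lra.
have cF : {within `[sl, sr], continuous F}.
  (* The Lipschitz bound degenerates at 0, so [F] is replaced by a function clamped at [sl], which
     is continuous on the whole line. *)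
  apply: (@subspace_eq_continuous _ _ _ (fun s => F (Num.max s sl))).
    move=> s; rewrite inE /= in_itv /= => /andP[h _].
    by rewrite /from_subspace /=; congr F; apply/max_idPl.
  apply: within_cts => s; apply/cvgrPdist_lt => e ep.
  pose M := E + sl^-1.
  have M0 : 0 < M by rewrite addr_gt0 // invr_gt0.
  near=> t.
  have st' : `|s - t| < e / M by near: t; apply/nbhs_ballP; exists (e / M); first by rewrite /= divr_gt0.
  set s' := Num.max s sl; set t' := Num.max t sl.
  have d : `|s' - t'| <= `|s - t|.
    by rewrite /s' /t' !maxEle; case: (leP s sl) => ?; case: (leP t sl) => ?;
       rewrite ?subrr ?normr0 // !ler_norml; apply/andP; split;
       case: (ger0P (s - t)); lra.
  have hs : sl <= s' by rewrite /s' le_max lexx orbT.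
  have ht : sl <= t' by rewrite /t' le_max lexx orbT.
  have l := ground_energy_lipschitz sl0 ht hs.
  rewrite /F; have -> : s' * E - L s' - (t' * E - L t') = E * (s' - t') - (L s' - L t') by ring.
  apply: le_lt_trans (ler_normB _ _) _; rewrite normrM (gtr0_norm E0).
  apply: le_lt_trans (_ : M * `|s - t| < _); last by rewrite mulrC -ltr_pdivlMr.
  rewrite /M mulrDl; apply: lerD; first by rewrite ler_wpM2l // ltW.
  by apply: le_trans l _; rewrite ler_wpM2l // invr_ge0 ltW.
have [s2 s2in hs2] := EVT_min (le_trans sl1 sr1) cF.
rewrite in_itv /= in s2in; case/andP: s2in => a1 a2.
have b1 : F s2 <= F s1 by apply: hs2; rewrite in_itv /= sl1 sr1.
exists s2; first by lra.
move=> s s0; have [h1|h1] := leP s sl; first exact: le_trans b1 (small _ s0 h1).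
have [h2|h2] := leP sr s; first exact: le_trans b1 (large _ h2).
by apply: hs2; rewrite in_itv /= (ltW h1) (ltW h2).
Unshelve. all: by end_near. Qed.

Section Minimizer.
Variable s1 : R.
Hypotheses (s10 : 0 < s1) (min_s1 : forall s, 0 < s -> F s1 <= F s).

(** Both [var_P] and [E] are compared with the slope [N] of [ground_second_order]: the state gives
    an affine upper bound touching [L] at [s1], and minimality of [F] makes the line of slope [E]
    through the same point another one. *)
Lemma envelope u v du dv th : state u v du dv ->
  s1 * var_P u v du dv - exp_dir th u v = L s1 -> var_P u v du dv = E.
Proof.
move=> st eq1.
have [psi [psi' gs]] := ground_energy_exists s10.
have [N [K hNK]] := ground_second_order s10 gs.
have nN : var_P u v du dv - N = 0.
  apply: (@second_order_slope s1 _ K) => // t t0.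
  by have := hNK t u v du dv th t0 st; lra.
have EN : E - N = 0.
  apply: (@second_order_slope s1 _ K) => // t t0.
  have [u' [v' [du' [dv' [st' eq']]]]] := ground_energy_attained t0.
  have := hNK t _ _ _ _ 0 t0 st'; rewrite eq'.
  by have := min_s1 t0; rewrite /F; lra.
lra.
Qed.

Lemma exp_dir_bound u v du dv th : state u v du dv -> var_P u v du dv <= E ->
  exp_dir th u v <= F s1.
Proof.
move=> st nE; have := ground_energy_lower th s10 st.
have : s1 * var_P u v du dv <= s1 * E by rewrite ler_pM2l.
by rewrite /F; lra.
Qed.

Lemma minimizer_exists : exists u v du dv,
  [/\ state u v du dv, var_P u v du dv = E & exp_dir 0 u v = F s1].
Proof.
have [u [v [du [dv [st e]]]]] := ground_energy_attained s10.
have n := envelope st e.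
by exists u, v, du, dv; split=> //; rewrite /F -e n; ring.
Qed.

(** Squares of [F] are compared with squares of mean cosines, so its sign matters; some direction of
    the optimal state has a nonnegative mean. *)
Lemma dual_min_ge0 : 0 <= F s1.
Proof.
have [u [v [du [dv [st n _]]]]] := minimizer_exists.
have [th [pos _]] := exp_polar u v.
by apply: le_trans pos _; apply: exp_dir_bound st _; rewrite n.
Qed.

Lemma var_cossin_lower u v du dv : state u v du dv -> var_P u v du dv <= E ->
  1 - F s1 ^+ 2 <= var_cossin u v.
Proof.
move=> st nE; rewrite (var_cossinE st).
have [th [pos e]] := exp_polar u v.
have : exp_dir th u v ^+ 2 <= F s1 ^+ 2.
  by rewrite ler_sqr ?nnegrE ?dual_min_ge0 //; exact: exp_dir_bound st nE.
by rewrite e; lra.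
Qed.

Lemma var_cossin_eq u v du dv th : state u v du dv -> var_P u v du dv <= E ->
  exp_dir th u v = F s1 -> var_cossin u v = 1 - F s1 ^+ 2.
Proof.
move=> st nE e; apply/eqP; rewrite eq_le (var_cossin_lower st nE) andbT (var_cossinE st).
by have := exp_dir_le u v th; rewrite e; lra.
Qed.

(** [r] and [alpha] form a complex constant. The integer [k] appears because multiplication by
    [exp (i k x)] shifts the momentum by [k] and changes neither the density nor the variance of
    [P]. *)
Lemma minimizer_iff u v du dv : state u v du dv ->
  (var_P u v du dv <= E /\ var_cossin u v = 1 - F s1 ^+ 2) <->
  exists (y : R -> R) (r alpha theta0 : R) (k : int),
    is_ce0 (- (2 / s1)) y /\
    forall x,
      u x = r * cos (k%:~R * x + alpha) * y ((x - theta0) / 2) /\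
      v x = r * sin (k%:~R * x + alpha) * y ((x - theta0) / 2).
Proof.
move=> st; have [psi [psi' gs]] := ground_energy_exists s10.
split=> [[nE me]|[y [r [alpha [th [k [hy huv]]]]]]].
  have [th [pos e]] := exp_polar u v.
  have eF : exp_dir th u v = F s1.
    apply/eqP; rewrite -(@eqrXn2 _ 2) ?dual_min_ge0 //; apply/eqP.
    by move: me; rewrite (var_cossinE st) e; lra.
  (* By the ground state identity [L s1 + s1 * defect = s1 * var_P - F s1 <= s1 E - F s1 = L s1],
     leaving no room for a positive defect. *)
  have d0 : defect (exp_P u v du dv) (fun x => log_der psi psi' (x - th)) u v du dv = 0.
    apply/eqP; rewrite eq_le defect_ge0 andbT -(pmulr_rle0 _ s10).
    have := ground_identity s10 gs th st; rewrite eF /F.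
    have : s1 * var_P u v du dv <= s1 * E by rewrite ler_pM2l.
    lra.
  have [r [alpha [k hk]]] := zero_defect_phase_state s10 gs st d0.
  exists (fun x => psi (2 * x)), r, alpha, th, k; split; first exact: ce0_ground_state gs.
  by move=> x; have -> : 2 * ((x - th) / 2) = x - th by [field]; exact: hk.
have [c hc] := ground_state_ce0 s10 gs hy.
have d0 : defect (exp_P u v du dv) (fun x => log_der psi psi' (x - th)) u v du dv = 0.
  have e x : 2 * ((x - th) / 2) = x - th by field.
  apply: (phase_state_defect (c := r * c) (p := k%:~R) (alpha := alpha) s10 gs st) => x.
    by rewrite (huv x).1 hc e; ring.
  by rewrite (huv x).2 hc e; ring.
have e1 := ground_identity s10 gs th st; rewrite d0 mulr0 addr0 in e1.
have n := envelope st e1.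
have nE : var_P u v du dv <= E by rewrite n.
split=> //; apply: (var_cossin_eq st nE (th := th)).
by rewrite /F -e1 n; ring.
Qed.

End Minimizer.
End Bound.
End Minimization.

Theorem theorem10 (R : realType) (E : R) (hE : 0 < E) :
  let g := fun s : R => 1 - (s * E - s * a0 (2 / s) / 4) ^+ 2 in
  let h := fun s : R => s * a0 (2 / s) / 4 + 1 - s * E in
  let adm := fun u v du dv : R -> R =>
    [/\ H1per_deriv u du, H1per_deriv v dv, unit_state u v & var_P u v du dv <= E] in
  exists m : R,
    (* m is the minimum of Delta^2(cos Q, sin Q) under Delta^2 P <= E *)
    ((exists u v du dv, adm u v du dv /\ var_cossin u v = m) /\
     (forall u v du dv, adm u v du dv -> m <= var_cossin u v)) /\
    (* m is the maximum over s > 0 of 1 - (sE - s a_0(2/s)/4)^2 *)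
    ((exists s, 0 < s /\ g s = m) /\ (forall s, 0 < s -> g s <= m)) /\
    (* the argmax s_E exists *)
    (exists sE, 0 < sE /\ forall s, 0 < s -> h s <= h sE) /\
    (* characterization of the minimizers *)
    (forall sE, 0 < sE -> (forall s, 0 < s -> h s <= h sE) ->
     forall u v du dv : R -> R,
       H1per_deriv u du -> H1per_deriv v dv -> unit_state u v ->
       ((var_P u v du dv <= E /\ var_cossin u v = m) <->
        exists (y : R -> R) (r alpha theta0 : R) (k : int),
          is_ce0 (- (2 / sE)) y /\
          forall x,
            u x = r * cos (k%:~R * x + alpha) * y ((x - theta0) / 2) /\
            v x = r * sin (k%:~R * x + alpha) * y ((x - theta0) / 2))).
Proof.
move=> g h adm.
have [s1 s10 min1] := dual_min_exists hE.
pose F s := s * E - ground_energy s.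
have F0 := dual_min_ge0 s10 min1.
exists (1 - F s1 ^+ 2); split; [split|split; [split|split]].
- have [u [v [du [dv [st n e]]]]] := minimizer_exists s10 min1.
  have nE : var_P u v du dv <= E by rewrite n.
  exists u, v, du, dv; split; first by case: st.
  exact: (var_cossin_eq s10 min1 st nE e).
- move=> u v du dv [h1 h2 h3 nE].
  by apply: (var_cossin_lower s10 min1 (du := du) (dv := dv)).
- by exists s1.
(* [g = 1 - F^2] is largest where [F] is smallest only because [F] is nonnegative throughout. *)
- move=> s s0; rewrite /g lerD2l lerN2 ler_sqr ?nnegrE //; first exact: min1.
  exact: le_trans F0 (min1 s s0).
- by exists s1; split => // s /min1; rewrite /h /ground_energy; lra.
- move=> sE sE0 hs u v du dv h1 h2 h3.
  (* [h = 1 - F], so every maximizer of [h] minimizes [F] and may take the place of [s1]; its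
     uniqueness is not called upon. *)
  have minE s : 0 < s -> F sE <= F s by move=> /hs; rewrite /h /F /ground_energy; lra.
  have -> : F s1 = F sE by apply/eqP; rewrite eq_le minE // andbT; exact: min1.
  by apply: minimizer_iff => //; split.
Qed.
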